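(* Let $\Delta>0$ be the discriminant of a real quadratic field, $D=|\Delta|=\Delta$, $\chi=\chi_\Delta$, and let $P_\Delta$ be the corresponding generalized Paley graph. Then its Cheeger number satisfies \[ h(P_\Delta)\leq \alpha:=\frac{1}{8\lfloor D/2\rfloor}\left(D\varphi(D)-\mu(D)\varphi(D)-\frac{8D\sqrt{D}}{\pi^2}\left(1-\frac{\chi(2)}{4}\right)L(2,\chi)\right). \]
   Context: Let $m\neq 1$ be a squarefree integer and let $\Delta$ be the discriminant of the quadratic field $\mathbb{Q}(\sqrt{m})$: $\Delta=m$ if $m\equiv 1\pmod 4$, and $\Delta=4m$ if $m\equiv 2,3\pmod 4$. Put $D=|\Delta|$. The function $\chi_\Delta(a)=\left(\frac{\Delta}{a}\right)$ (Kronecker symbol, $a\in\mathbb{Z}$) is the associated primitive quadratic Dirichlet character of conductor $D$; it is periodic mod $D$ and vanishes when $\gcd(a,D)>1$. The generalized Paley graph $P_\Delta$ has vertex set $\{0,1,\dots,D-1\}$, with $u$ and $v$ connected if and only if $\chi_\Delta(v-u)=1$. It is undirected when $\Delta>0$. For an undirected graph $G$ with vertex set $V(G)$ and $F\subseteq V(G)$, the boundary $\partial F$ is the set of all edges going from a vertex in $F$ to a vertex outside $F$. The Cheeger number is \[ h(G)=\min\left\{\frac{|\partial F|}{|F|} : F\subseteq V(G),\ 0<|F|\leq \tfrac12|V(G)|\right\}. \] Here $\varphi$ is Euler's totient function, $\mu$ is the Möbius function, and $L(2,\chi)=\sum_{n=1}^\infty \chi(n)/n^2$. *)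

(* Defs.v *)
From HB Require Import structures.
From mathcomp Require Import all_boot all_order all_algebra.
From mathcomp Require Import all_classical all_reals all_analysis.

Set Implicit Arguments.
Unset Strict Implicit.
Unset Printing Implicit Defensive.

Import Order.TTheory GRing.Theory Num.Theory.
Import numFieldNormedType.Exports.

Local Open Scope ring_scope.

(* 0 is not squarefree, since 0 ^ 2 %| 0. *)
Definition squarefree (n : nat) : bool :=
  [forall d : 'I_n.+1, (d ^ 2 %| n)%N ==> (d == 1 :> nat)].

Definition mobius (n : nat) : int :=
  if squarefree n then (-1) ^+ size (primes n) else 0.

Definition legendre (a : int) (p : nat) : int :=
  if (p %| a)%Z then 0
  else if [exists x : 'I_p, (p %| (x : nat)%:Z ^+ 2 - a)%Z] then 1 else -1.

Definition kronecker_prime (a : int) (p : nat) : int :=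
  if p == 2%N then
    if (2 %| a)%Z then 0
    else if ((a %% 8)%Z == 1) || ((a %% 8)%Z == 7) then 1 else -1
  else legendre a p.

Definition kronecker_unit (a n : int) : int :=
  if (n < 0) && (a < 0) then -1 else 1.

Definition kronecker (a n : int) : int :=
  if n == 0 then (`|a| == 1)%:R
  else kronecker_unit a n *
       \prod_(pk <- prime_decomp `|n|%N) kronecker_prime a pk.1 ^+ pk.2.

Definition quad_disc (m : int) : int :=
  if (m %% 4)%Z == 1 then m else 4 * m.

Definition paley_adj (Delta : int) : rel 'I_`|Delta|%N :=
  fun u v => kronecker Delta ((v : nat)%:Z - (u : nat)%:Z) == 1.

Lemma paley_adj_sym (Delta : int) : 0 < Delta -> symmetric (@paley_adj Delta).
Proof.
move=> Delta_gt0 u v; rewrite /paley_adj -opprB /kronecker oppr_eq0 abszN.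
by rewrite /kronecker_unit (lt_gtF Delta_gt0) !andbF.
Qed.

(* The edges of an undirected graph are unordered pairs of vertices. *)
Definition edge_boundary (V : finType) (adj : rel V) (F : {set V}) :
    {set {set V}} :=
  [set [set u; v] | u in F, v in ~: F & adj u v].

Definition cheeger_admissible (V : finType) (F : {set V}) : bool :=
  (0 < #|F|)%N && (2 * #|F| <= #|V|)%N.

Definition cheeger_ratio (R : realType) (V : finType) (adj : rel V)
    (F : {set V}) : R :=
  #|edge_boundary adj F|%:R / #|F|%:R.

(* The infimum is over a finite set, nonempty as soon as there are two
   vertices, hence a minimum: see [cheeger_number_min]. *)
Definition cheeger_number (R : realType) (V : finType) (adj : rel V) : R :=
  inf [set cheeger_ratio R adj F | F in [set F | cheeger_admissible F]]%classic.

Lemma cheeger_number_min (R : realType) (V : finType) (adj : rel V) :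
  (1 < #|V|)%N ->
  (exists2 F : {set V}, cheeger_admissible F &
     cheeger_number R adj = cheeger_ratio R adj F) /\
  (forall F : {set V}, cheeger_admissible F ->
     cheeger_number R adj <= cheeger_ratio R adj F).
Proof.
move=> V_gt1.
have /card_gt0P[x _] : (0 < #|V|)%N by exact: ltnW.
have adm1 : cheeger_admissible [set x].
  by rewrite /cheeger_admissible cards1 muln1.
have [F admF minF] := arg_minP (cheeger_ratio R adj) adm1.
have inf_le G : cheeger_admissible G ->
    cheeger_number R adj <= cheeger_ratio R adj G.
  move=> admG; apply: ge_inf; last by exists G.
  by exists (cheeger_ratio R adj F) => _ [H admH <-]; exact: minF.
split=> //; exists F => //; apply/eqP; rewrite eq_le inf_le //=.
apply: lb_le_inf; first by exists (cheeger_ratio R adj F), F.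
by move=> _ [H admH <-]; exact: minF.
Qed.

Definition dirichlet_L (R : realType) (s : nat) (chi : int -> int) : R :=
  limn (series (fun n : nat => (chi n.+1%:Z)%:~R / n.+1%:R ^+ s : R)).

(* Main.v *)
Require Import Defs.
From HB Require Import structures.
From mathcomp Require Import all_boot all_order all_fingroup all_algebra.
From mathcomp Require Import all_classical all_reals all_analysis.
From mathcomp Require Import zify ring lra.

(* Take F = {0, ..., floor(D/2) - 1}.  A difference d mod D is realised by
   ||d|| = min(d, D - d) pairs across the cut, so
   |boundary of F| = (sum_d ||d|| chi_0(d) + sum_d ||d|| chi(d)) / 2, with chi_0
   the principal character, and |boundary of F| / |F| turns out to be exactly
   the stated bound.  The first sum is elementary.  The second one is a finite
   Fourier computation: for M even, the M-periodic triangle wave has Fourier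
   coefficients 1 / sin^2(pi k / M) supported on the odd k; letting M -> oo along
   multiples of D turns them into multiples of 1 / k^2 with an error term
   controlled by 0 <= 1/sin^2 y - 1/y^2 <= 1.

   This needs sum_u chi(u) cos(2 pi k u / D) = sqrt(D) chi(k), including the sign.
   The matrix (cos(2 pi a j k / n)), folded along k ~ -k, squares to n, hence its
   trace, the real part of the quadratic Gauss sum G(a; n), is sqrt(n) times an
   integer whose residue mod 4 is read off the sign of the determinant.  For
   a = 1 that determinant is a Vandermonde determinant in decreasing cosines;
   together with |G|^2 <= 2 n this evaluates G(1; n) for all n (imaginary parts
   via the sine matrix).  The permutation of rows induced by a shows that
   a |-> Re G(a; D) / sqrt(D) is multiplicative when D = 0, 1 mod 4, and the
   reciprocity G(1; p D) = G(p; D) G(D; p) identifies it with the Kronecker symbol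
   (D/p) at every prime p. *)

Set Implicit Arguments.
Unset Strict Implicit.
Unset Printing Implicit Defensive.

Import Order.TTheory GRing.Theory Num.Theory.
Import numFieldNormedType.Exports.

Local Open Scope ring_scope.

(** * Traces and determinants *)

(** Both sides are the determinant of the block matrix [1, X; Y, 1], factored by eliminating either
    off-diagonal block. *)
Lemma det_1subM_comm (K : comPzRingType) (m n : nat) (X : 'M[K]_(m, n))
    (Y : 'M[K]_(n, m)) : \det (1%:M - X *m Y) = \det (1%:M - Y *m X).
Proof.
have e1 : block_mx 1%:M X Y 1%:M =
    block_mx 1%:M 0 Y 1%:M *m block_mx 1%:M X 0 (1%:M - Y *m X).
  by rewrite mulmx_block ?(mul0mx, mul1mx, mulmx1, mulmx0, addr0) addrC subrK.
have e2 : block_mx 1%:M X Y 1%:M =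
    block_mx 1%:M X 0 1%:M *m block_mx (1%:M - X *m Y) 0 Y 1%:M.
  by rewrite mulmx_block ?(mul0mx, mul1mx, mulmx1, mulmx0, addr0, add0r) subrK.
have := congr1 determinant e1; rewrite {1}e2 !det_mulmx !det_ublock !det_lblock !det1.
by rewrite !(mul1r, mulr1).
Qed.

(** Rank factorization P = X Y: X is left-invertible and Y right-invertible, so both can be
    cancelled in X Y X Y = X Y. *)
Lemma idempotent_factor (K : fieldType) (n : nat) (P : 'M[K]_n) :
  P *m P = P -> exists m (X : 'M[K]_(n, m)) (Y : 'M[K]_(m, n)), P = X *m Y /\ Y *m X = 1%:M.
Proof.
move=> PP; exists (\rank P), (col_base P), (row_base P).
split; first by rewrite mulmx_base.
have /row_freeP := row_base_free P; have /row_fullP := col_base_full P.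
move: (row_base P) (col_base P) (mulmx_base P); move: (\rank P) => r.
move=> Y X XY [W WX] [Z YZ].
have : W *m (P *m P) *m Z = W *m P *m Z by rewrite PP.
by rewrite -XY !mulmxA WX !mul1mx -!mulmxA YZ mulmx1.
Qed.

(** A / sqrt(c) is an involution, hence 1 - 2 P with P idempotent. With m the rank of P, the trace
    is N - 2 m and the determinant (-1)^m: the sign of the determinant knows the trace modulo 4. *)
Lemma scaled_involution (K : rcfType) (N : nat) (A : 'M[K]_N) (c : K) :
  0 < c -> A *m A = c%:M ->
  exists m : nat, \tr A = Num.sqrt c * (N%:R - 2 * m%:R) /\ Num.sg (\det A) = (-1) ^+ m.
Proof.
move=> c0 AA; set s := Num.sqrt c.
have s0 : 0 < s by rewrite sqrtr_gt0.
have s2 : s * s = c by rewrite -expr2 sqr_sqrtr ?ltW.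
have [B [AE BB]] : exists B, A = s *: B /\ B *m B = 1%:M.
  exists (s^-1 *: A); rewrite scalerA divff ?scale1r ?gt_eqF //; split=> //.
  rewrite -scalemxAl -scalemxAr scalerA AA scale_scalar_mx.
  by congr (_%:M); rewrite -s2; field; rewrite gt_eqF.
have two_neq0 : (2 : K) != 0 by rewrite pnatr_eq0.
have [P [BE PP]] : exists P, B = 1%:M - 2 *: P /\ P *m P = P.
  exists (2^-1 *: (1%:M - B)); split.
    by rewrite scalerA divff // scale1r subKr.
  rewrite -scalemxAl -scalemxAr scalerA mulmxBl !mulmxBr BB !mul1mx mulmx1.
  have -> : 1%:M - B - (B - 1%:M) = 2 *: (1%:M - B) :> 'M[K]_N.
    by rewrite scaler_nat mulr2n opprB.
  by rewrite scalerA; congr (_ *: _); field.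
have [m [X [Y [PE YX]]]] := idempotent_factor PP.
exists m.
split.
  rewrite AE mxtraceZ BE linearB /= mxtraceZ PE mxtrace_mulC YX !mxtrace1.
  by [].
have -> : \det A = s ^+ N * (-1) ^+ m.
  rewrite AE detZ; congr (_ * _).
  rewrite BE PE scalemxAl det_1subM_comm -scalemxAr YX.
  have -> : 1%:M - 2 *: 1%:M = (-1) *: 1%:M :> 'M[K]_m.
    by rewrite -{1}(scale1r 1%:M) -scalerBl; congr (_ *: _); ring.
  by rewrite detZ det1 mulr1.
by rewrite sgrM sgrX gtr0_sg // expr1n mul1r sgrX sgrN sgr1.
Qed.

Lemma sg_prod_seq (K : realDomainType) (I : Type) (r : seq I) (P : pred I) (F : I -> K) :
  Num.sg (\prod_(i <- r | P i) F i) = \prod_(i <- r | P i) Num.sg (F i).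
Proof.
by apply: (big_morph _ (fun x y => sgrM x y)); rewrite sgr1.
Qed.

(** The matrix is a triangular matrix of coefficients, with positive diagonal, times a Vandermonde
    matrix whose 'C(N, 2) differences are all negative. *)
Lemma sgdet_poly_decreasing (K : realFieldType) (N : nat) (P : nat -> {poly K})
    (c : 'I_N -> K) :
  (forall j, size (P j) = j.+1) -> (forall j, 0 < lead_coef (P j)) ->
  (forall j k : 'I_N, (j < k)%N -> c k < c j) ->
  Num.sg (\det (\matrix_(j < N, k < N) (P j).[c k])) = (-1) ^+ 'C(N, 2).
Proof.
move=> szP lcP cdec.
pose L : 'M[K]_N := \matrix_(j, i) (P j)`_i.
pose V := Vandermonde N (\row_k c k).
have -> : \matrix_(j, k) (P j).[c k] = L *m V.
  apply/matrixP=> j k; rewrite !mxE (@horner_coef_wide _ N) ?szP //.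
  by apply: eq_bigr => i _; rewrite !mxE.
rewrite det_mulmx sgrM det_trig; last first.
  apply/is_trig_mxP => j i ji; rewrite mxE nth_default // szP //.
rewrite gtr0_sg ?mul1r; last first.
  by apply: prodr_gt0 => i _; rewrite mxE; have := lcP i; rewrite lead_coefE szP.
rewrite det_Vandermonde sg_prod_seq.
under eq_bigr => i _.
  rewrite sg_prod_seq.
  under eq_bigr => j ij do rewrite !mxE ltr0_sg ?subr_lt0 ?cdec //.
  over.
rewrite (exchange_big_dep xpredT) //= -bin2_sum big_mkord -prodrXr.
apply: eq_bigr => j _; rewrite prodr_const; congr (_ ^+ _).
rewrite -sum1_card -[RHS]card_ord -sum1_card.
by rewrite (big_ord_widen N (fun=> 1%N)) // ltnW.
Qed.

(** * Chebyshev polynomials of both kinds *)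

Section Chebyshev.
Variable R : realType.

(** Both kinds satisfy the same recurrence: p = 'X gives the first kind, p = 2 *: 'X the second. *)
Fixpoint chebyshev (p : {poly R}) (n : nat) : {poly R} :=
  match n with
  | 0 => 1
  | n'.+1 => match n' with
             | 0 => p
             | n''.+1 => 2 *: (chebyshev p n' * 'X) - chebyshev p n''
             end
  end.

Lemma chebyshevS (p : {poly R}) (n : nat) :
  chebyshev p n.+2 = 2 *: (chebyshev p n.+1 * 'X) - chebyshev p n.
Proof. by []. Qed.

Lemma size_lead_chebyshev (p : {poly R}) (n : nat) :
  size p = 2 -> 0 < lead_coef p ->
  size (chebyshev p n) = n.+1 /\ 0 < lead_coef (chebyshev p n).
Proof.
move=> sp lp.
suff: (size (chebyshev p n) = n.+1 /\ 0 < lead_coef (chebyshev p n)) /\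
  (size (chebyshev p n.+1) = n.+2 /\ 0 < lead_coef (chebyshev p n.+1)) by case.
elim: n => [|n [[s0 l0] [s1 l1]]]; first by rewrite /= size_poly1 lead_coef1.
split=> //; rewrite chebyshevS.
have p0 : chebyshev p n.+1 != 0 by rewrite -size_poly_eq0 s1.
have s2 : size (2 *: (chebyshev p n.+1 * 'X)) = n.+3.
  by rewrite size_scale ?pnatr_eq0 // size_mulX // s1.
have lt : (size (- chebyshev p n) < size (2 *: (chebyshev p n.+1 * 'X)))%N.
  by rewrite size_polyN s0 s2.
rewrite size_polyDl // s2; split=> //.
by rewrite lead_coefDl // lead_coefZ lead_coefMX mulr_gt0.
Qed.

Lemma cos_chebyshev (n : nat) (t : R) :
  cos (n%:R * t) = (chebyshev 'X n).[cos t].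
Proof.
suff: cos (n%:R * t) = (chebyshev 'X n).[cos t] /\
      cos (n.+1%:R * t) = (chebyshev 'X n.+1).[cos t] by case.
elim: n => [|n [h0 h1]]; first by rewrite mul0r cos0 mul1r !hornerE.
split=> //; rewrite chebyshevS hornerD hornerN hornerZ hornerMX -h0 -h1.
have -> : n.+2%:R * t = n.+1%:R * t + t by rewrite -(natr1 n.+1); ring.
have -> : n%:R * t = n.+1%:R * t - t by rewrite -(natr1 n); ring.
by rewrite cosB cosD; ring.
Qed.

Lemma sin_chebyshev (n : nat) (t : R) :
  sin (n.+1%:R * t) = sin t * (chebyshev (2 *: 'X) n).[cos t].
Proof.
suff: sin (n.+1%:R * t) = sin t * (chebyshev (2 *: 'X) n).[cos t] /\
      sin (n.+2%:R * t) = sin t * (chebyshev (2 *: 'X) n.+1).[cos t] by case.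
elim: n => [|n [h0 h1]].
  rewrite /= hornerC hornerZ hornerX; split; first by rewrite mul1r mulr1.
  by rewrite -(natr1 1) mulrDl mul1r sinD; ring.
split=> //; rewrite chebyshevS hornerD hornerN hornerZ hornerMX.
have -> : n.+3%:R * t = n.+2%:R * t + t by rewrite -(natr1 n.+2); ring.
have : sin (n.+1%:R * t) = sin (n.+2%:R * t - t).
  by congr sin; rewrite -(natr1 n.+1); ring.
rewrite h0 sinB sinD h1; lra.
Qed.

End Chebyshev.

(** * Periodic sums and waves *)

Definition zperiodic (V : Type) (n : nat) (f : int -> V) :=
  forall z, f (z + n%:Z) = f z.

Lemma zperiodicM (V : Type) (n : nat) (f : int -> V) (z w : int) :
  zperiodic n f -> f (z + w * n%:Z) = f z.
Proof.
move=> fp; have pos (k : nat) x : f (x + k%:Z * n%:Z) = f x.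
  elim: k => [|k IH]; first by rewrite mul0r addr0.
  by rewrite -addn1 PoszD mulrDl mul1r addrA fp IH.
case: w => k; first exact: pos.
by rewrite NegzE mulNr -[LHS](pos k.+1) subrK.
Qed.

Lemma zperiodic_eq (V : Type) (n : nat) (f : int -> V) (z w : int) :
  zperiodic n f -> (n%:Z %| z - w)%Z -> f z = f w.
Proof.
move=> fp /dvdzP[q e]; rewrite -(zperiodicM w q fp); congr f.
by rewrite -e; ring.
Qed.

(** * Sums over complete residue systems *)

Section PeriodicSums.
Variable V : zmodType.
Implicit Types (f : int -> V) (n : nat).

(** Reduction modulo n is injective on n pairwise incongruent integers, hence bijective onto the
    residues. The changes of variables that follow are instances. *)
Lemma sum_residues n f (T : finType) (h : T -> int) :
  (0 < n)%N -> zperiodic n f -> #|T| = n ->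
  (forall s t, (n%:Z %| h s - h t)%Z -> s = t) ->
  \sum_t f (h t) = \sum_(x < n) f x%:Z.
Proof.
case: n => // n _ fp cT hinj.
have rlt t : (`|(h t %% n.+1%:Z)%Z|%N < n.+1)%N.
  by rewrite -ltz_nat gez0_abs ?modz_ge0 // ltz_pmod.
pose g t : 'I_n.+1 := Ordinal (rlt t).
have ginj : injective g.
  move=> s t /(congr1 val) /= e; apply: hinj; rewrite -eqz_mod_dvd.
  by apply/eqP; move: e => /(congr1 Posz); rewrite !gez0_abs ?modz_ge0.
have gbij : bijective g by apply: inj_card_bij => //; rewrite cT card_ord.
rewrite [RHS](reindex g) /=; last exact: onW_bij.
apply: eq_bigr => t _; rewrite /g /= gez0_abs ?modz_ge0 //.
apply: (zperiodic_eq fp); rewrite /modz opprB addrCA subrr addr0 dvdz_mull //.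
Qed.

Lemma dvdz_addl (d x y : int) : (d %| y)%Z -> (d %| x + y)%Z = (d %| x)%Z.
Proof. exact: rpredDr. Qed.

Lemma dvdz_addr (d x y : int) : (d %| x)%Z -> (d %| x + y)%Z = (d %| y)%Z.
Proof. exact: rpredDl. Qed.

Lemma dvdz_opp (d x : int) : (d %| - x)%Z = (d %| x)%Z.
Proof. exact: rpredN. Qed.

Lemma ord_eq_mod n (s t : 'I_n) : (n%:Z %| s%:Z - t%:Z)%Z -> s = t.
Proof.
rewrite -eqz_mod_dvd !modz_nat !modn_small // => /eqP[e].
exact: val_inj.
Qed.

Lemma sum_shift n f (h : int) : (0 < n)%N -> zperiodic n f ->
  \sum_(x < n) f (x%:Z + h) = \sum_(x < n) f x%:Z.
Proof.
move=> n0 fp; apply: (@sum_residues n f 'I_n (fun x => x%:Z + h)) => //.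
  by rewrite card_ord.
move=> s t; rewrite (_ : _ - _ = s%:Z - t%:Z); first exact: ord_eq_mod.
by ring.
Qed.

Lemma sum_unit n f (a : int) : (0 < n)%N -> zperiodic n f -> coprimez n a ->
  \sum_(x < n) f (a * x%:Z) = \sum_(x < n) f x%:Z.
Proof.
move=> n0 fp na; apply: (@sum_residues n f 'I_n (fun x => a * x%:Z)) => //.
  by rewrite card_ord.
by move=> s t; rewrite -mulrBr Gauss_dvdzr //; exact: ord_eq_mod.
Qed.

Lemma sum_crt a b f : (0 < a)%N -> (0 < b)%N -> coprime a b -> zperiodic (a * b) f ->
  \sum_(y < a) \sum_(z < b) f (b%:Z * y%:Z + a%:Z * z%:Z) = \sum_(x < a * b) f x%:Z.
Proof.
move=> a0 b0 ab fp; rewrite pair_bigA /=.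
apply: (@sum_residues (a * b) f _
  (fun u : 'I_a * 'I_b => b%:Z * u.1%:Z + a%:Z * u.2%:Z)) => //.
- by rewrite muln_gt0 a0.
- by rewrite card_prod !card_ord.
move=> [y z] [y' z'] /=; rewrite PoszM.
rewrite (_ : _ - _ = b%:Z * (y%:Z - y'%:Z) + a%:Z * (z%:Z - z'%:Z)); last by ring.
rewrite Gauss_dvdz //= => /andP[].
rewrite dvdz_addl; last exact: dvdz_mulr.
rewrite Gauss_dvdzr // => /ord_eq_mod ->.
rewrite dvdz_addr; last exact: dvdz_mulr.
rewrite Gauss_dvdzr; last by rewrite coprimezE coprime_sym.
by move=> /ord_eq_mod ->.
Qed.

Lemma sum_classes k n f : (0 < k)%N -> (0 < n)%N -> zperiodic (k * n) f ->
  \sum_(i < k) \sum_(x < n) f (i%:Z + k%:Z * x%:Z) = \sum_(x < k * n) f x%:Z.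
Proof.
move=> k0 n0 fp; rewrite pair_bigA /=.
apply: (@sum_residues (k * n) f _ (fun u : 'I_k * 'I_n => u.1%:Z + k%:Z * u.2%:Z)) => //.
- by rewrite muln_gt0 k0.
- by rewrite card_prod !card_ord.
move=> [i x] [i' x'] /=; rewrite PoszM.
rewrite (_ : _ - _ = (i%:Z - i'%:Z) + k%:Z * (x%:Z - x'%:Z)); last by ring.
move=> kn; have : (k%:Z %| (i%:Z - i'%:Z) + k%:Z * (x%:Z - x'%:Z))%Z.
  by apply: dvdz_trans kn; rewrite dvdz_mulr.
rewrite dvdz_addl; last exact: dvdz_mulr.
move=> /ord_eq_mod ii; move: kn.
rewrite ii subrr add0r dvdz_mul2l ?eqz_nat -?lt0n // => /ord_eq_mod -> //.
Qed.

Lemma sum_periods k n f : (0 < k)%N -> (0 < n)%N -> zperiodic n f ->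
  \sum_(x < k * n) f x%:Z = (\sum_(x < n) f x%:Z) *+ k.
Proof.
move=> k0 n0 fp.
have fpk : zperiodic (n * k) f.
  by move=> z; rewrite PoszM mulrC zperiodicM.
rewrite mulnC -sum_classes // exchange_big /=.
rewrite -[k in RHS]card_ord -sumr_const; apply: eq_bigr => i _.
by apply: eq_bigr => x _; rewrite mulrC zperiodicM.
Qed.

End PeriodicSums.

(** * Discrete waves and Gauss sums in real and imaginary parts *)

Section Waves.
Variable R : realType.
Implicit Types (n : nat) (z w : int).

(** Real and imaginary parts of exp(2 pi i z / n); identities between roots of unity are stated as
    pairs of real ones. *)
Definition zcos n z : R := cos (2 * pi * z%:~R / n%:R).
Definition zsin n z : R := sin (2 * pi * z%:~R / n%:R).

Lemma zcosD n z w : zcos n (z + w) = zcos n z * zcos n w - zsin n z * zsin n w.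
Proof. by rewrite /zcos intrD mulrDr mulrDl cosD. Qed.
Lemma zsinD n z w : zsin n (z + w) = zsin n z * zcos n w + zcos n z * zsin n w.
Proof. by rewrite /zsin intrD mulrDr mulrDl sinD. Qed.
Lemma zcosN n z : zcos n (- z) = zcos n z.
Proof. by rewrite /zcos mulrNz mulrN mulNr cosN. Qed.
Lemma zsinN n z : zsin n (- z) = - zsin n z.
Proof. by rewrite /zsin mulrNz mulrN mulNr sinN. Qed.
Lemma zcosB n z w : zcos n (z - w) = zcos n z * zcos n w + zsin n z * zsin n w.
Proof. by rewrite zcosD zcosN zsinN mulrN opprK. Qed.
Lemma zcos0 n : zcos n 0 = 1.
Proof. by rewrite /zcos mulr0 mul0r cos0. Qed.
Lemma zsin0 n : zsin n 0 = 0.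
Proof. by rewrite /zsin mulr0 mul0r sin0. Qed.
Lemma zcos2Dzsin2 n z : zcos n z ^+ 2 + zsin n z ^+ 2 = 1.
Proof. exact: cos2Dsin2. Qed.

Lemma zcos_scale k n z : (0 < k)%N -> zcos (k * n) (k%:Z * z) = zcos n z.
Proof.
move=> k0; case: n => [|n]; rewrite /zcos ?muln0 ?invr0 ?mulr0 //; congr cos.
by rewrite natrM intrM; field; rewrite nat1r !pnatr_eq0 -!lt0n k0.
Qed.
Lemma zsin_scale k n z : (0 < k)%N -> zsin (k * n) (k%:Z * z) = zsin n z.
Proof.
move=> k0; case: n => [|n]; rewrite /zsin ?muln0 ?invr0 ?mulr0 //; congr sin.
by rewrite natrM intrM; field; rewrite nat1r !pnatr_eq0 -!lt0n k0.
Qed.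

Lemma zcos_periodic n : (0 < n)%N -> zperiodic n (zcos n).
Proof.
move=> n0 z; rewrite /zcos -[RHS]cosD2pi; congr cos.
by rewrite intrD; field; rewrite pnatr_eq0 -lt0n.
Qed.
Lemma zsin_periodic n : (0 < n)%N -> zperiodic n (zsin n).
Proof.
move=> n0 z; rewrite /zsin -[RHS]sinD2pi; congr sin.
by rewrite intrD; field; rewrite pnatr_eq0 -lt0n.
Qed.

Lemma zcos_eq1 n z : (0 < n)%N -> zcos n z = 1 -> (n%:Z %| z)%Z.
Proof.
move=> n0 e; apply/dvdzP; exists (z %/ n)%Z.
have n0z : n%:Z != 0 by rewrite eqz_nat -lt0n.
rewrite [LHS](divz_eq z n) -[RHS]addr0; congr (_ + _).
have : zcos n (z %% n)%Z = 1.
  by rewrite -e {2}(divz_eq z n) addrC zperiodicM //; exact: zcos_periodic.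
have := modz_ge0 z n0z; have := ltz_pmod z (n0 : 0 < n%:Z).
case: (z %% n)%Z => // r rn _ {e}.
rewrite /zcos (_ : _ / _ = (pi * r%:R / n%:R) *+ 2); last first.
  by rewrite -mulr_natl; field; rewrite pnatr_eq0 -lt0n.
rewrite cos_mulr2n => e.
have : sin (pi * r%:R / n%:R : R) ^+ 2 = 0 by rewrite sin2cos2 -mulr_natr in e *; lra.
case: r rn {e} => // r rn /eqP; rewrite expf_eq0 /= gt_eqF // sin_gt0_pi //.
have nR : (0 : R) < n%:R by rewrite ltr0n.
have pi0 := pi_gt0 R.
apply/andP; split; first by rewrite divr_gt0 // mulr_gt0.
by rewrite ltr_pdivrMr // ltr_pM2l // ltr_nat -ltz_nat.
Qed.

(** The shift x -> x + 1 preserves both sums S and T but rotates the vector (S, T) by 2 pi z / n. If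
    n does not divide z, rotation minus identity has determinant 2 (1 - cos) != 0, so S = T = 0. *)
Lemma sum_waves n z : (0 < n)%N ->
  \sum_(x < n) zcos n (z * x%:Z) = (if (n%:Z %| z)%Z then n%:R else 0) /\
  \sum_(x < n) zsin n (z * x%:Z) = 0.
Proof.
move=> n0; case: ifPn => nz.
  have e x : (n%:Z %| z * x - 0)%Z by rewrite subr0 dvdz_mulr.
  split.
    under eq_bigr => x _ do rewrite (zperiodic_eq (zcos_periodic n0) (e _)) zcos0.
    by rewrite sumr_const card_ord.
  apply: big1 => x _.
  by rewrite (zperiodic_eq (zsin_periodic n0) (e _)) zsin0.
have pc : zperiodic n (fun x => zcos n (z * x)).
  by move=> x; rewrite mulrDr zperiodicM //; exact: zcos_periodic.
have ps : zperiodic n (fun x => zsin n (z * x)).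
  by move=> x; rewrite mulrDr zperiodicM //; exact: zsin_periodic.
have := sum_shift 1 n0 pc; have := sum_shift 1 n0 ps => /=.
under eq_bigr => x _ do rewrite mulrDr mulr1 zsinD.
rewrite big_split /= -!mulr_suml => e1.
under eq_bigr => x _ do rewrite mulrDr mulr1 zcosD.
rewrite big_split /= sumrN -!mulr_suml.
move: e1; set S := \sum_(x < n) zcos _ _; set T := \sum_(x < n) zsin _ _ => e1 e2.
have c1 : 2 * (1 - zcos n z) != 0.
  rewrite mulf_neq0 ?pnatr_eq0 // subr_eq0; apply: contraNneq nz => c.
  exact: zcos_eq1.
have cs2 := zcos2Dzsin2 n z.
split; apply: (mulfI c1); rewrite mulr0.
  have -> : 2 * (1 - zcos n z) * S = (zcos n z ^+ 2 + zsin n z ^+ 2 + 1 - 2 * zcos n z) * S.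
    by rewrite cs2; ring.
  move: e1 e2; set c := zcos n z; set s := zsin n z => e1 e2.
  transitivity ((1 - c) * (S - (S * c - T * s)) - s * (T - (T * c + S * s))); first by ring.
  by rewrite e1 e2 !subrr !mulr0 subrr.
have -> : 2 * (1 - zcos n z) * T = (zcos n z ^+ 2 + zsin n z ^+ 2 + 1 - 2 * zcos n z) * T.
  by rewrite cs2; ring.
move: e1 e2; set c := zcos n z; set s := zsin n z => e1 e2.
transitivity ((1 - c) * (T - (T * c + S * s)) + s * (S - (S * c - T * s))); first by ring.
by rewrite e1 e2 !subrr !mulr0 addr0.
Qed.

(** Real and imaginary parts of G(a; n), the sum of exp(2 pi i a x^2 / n) over x modulo n. *)
Definition gaussC (a : int) n := \sum_(x < n) zcos n (a * x%:Z ^+ 2).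
Definition gaussS (a : int) n := \sum_(x < n) zsin n (a * x%:Z ^+ 2).

Lemma zperiodic_sq (f : int -> R) n (a : int) : zperiodic n f ->
  zperiodic n (fun x => f (a * x ^+ 2)).
Proof.
move=> fp x; apply: (zperiodic_eq fp); apply/dvdzP.
by exists (a * (2 * x + n%:Z)); ring.
Qed.

Lemma gauss_eq_mod n a b : (0 < n)%N -> (n%:Z %| a - b)%Z ->
  gaussC a n = gaussC b n /\ gaussS a n = gaussS b n.
Proof.
move=> n0 ab; have e x : (n%:Z %| a * x - b * x)%Z by rewrite -mulrBl dvdz_mulr.
split; apply: eq_bigr => x _.
  exact: (zperiodic_eq (zcos_periodic n0) (e _)).
exact: (zperiodic_eq (zsin_periodic n0) (e _)).
Qed.

(** This is G(v; a b) = G(v b; a) G(v a; b): put x = b y + a z, whose square has a cross term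
    divisible by a b. *)
Lemma gauss_crt v a b : (0 < a)%N -> (0 < b)%N -> coprime a b ->
  gaussC v (a * b) = gaussC (v * b%:Z) a * gaussC (v * a%:Z) b
                     - gaussS (v * b%:Z) a * gaussS (v * a%:Z) b /\
  gaussS v (a * b) = gaussS (v * b%:Z) a * gaussC (v * a%:Z) b
                     + gaussC (v * b%:Z) a * gaussS (v * a%:Z) b.
Proof.
move=> a0 b0 ab; have ab0 : (0 < a * b)%N by rewrite muln_gt0 a0.
have e (y z : int) : ((a * b)%N%:Z %| v * (b%:Z * y + a%:Z * z) ^+ 2 -
    (b%:Z * (v * b%:Z * y ^+ 2) + a%:Z * (v * a%:Z * z ^+ 2)))%Z.
  by apply/dvdzP; exists (2 * v * y * z); rewrite PoszM; ring.
have zc w : zcos (a * b) (b%:Z * w) = zcos a w by rewrite mulnC zcos_scale.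
have zs w : zsin (a * b) (b%:Z * w) = zsin a w by rewrite mulnC zsin_scale.
split.
  rewrite /gaussC -(sum_crt a0 b0 ab (zperiodic_sq v (zcos_periodic ab0))).
  rewrite !mulr_suml -sumrB; apply: eq_bigr => y _.
  rewrite !mulr_sumr -sumrB; apply: eq_bigr => z _.
  rewrite (zperiodic_eq (zcos_periodic ab0) (e _ _)) zcosD.
  by rewrite !zc !zs !zcos_scale // !zsin_scale.
rewrite /gaussS -(sum_crt a0 b0 ab (zperiodic_sq v (zsin_periodic ab0))).
rewrite !mulr_suml -big_split /=; apply: eq_bigr => y _.
rewrite !mulr_sumr -big_split /=; apply: eq_bigr => z _.
rewrite (zperiodic_eq (zsin_periodic ab0) (e _ _)) zsinD.
by rewrite !zc !zs !zcos_scale // !zsin_scale.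
Qed.

End Waves.

Lemma sum_indicator_le1 (K : numDomainType) (n : nat) (P : pred nat) (c : nat) :
  (forall h, (h < n)%N -> P h -> h = c) -> \sum_(h < n) (P h)%:R <= 1 :> K.
Proof.
move=> Pc; have [cn|cn] := ltnP c n.
  rewrite (bigD1 (Ordinal cn)) //= big1 ?addr0; first by case: (P c); rewrite ?ler01.
  move=> i ic; case: (boolP (P i)) => // Pi.
  by case/eqP: ic; apply: val_inj; exact: (Pc i (ltn_ord i) Pi).
rewrite big1 ?ler01 // => i _; case: (boolP (P i)) => // Pi.
by have := Pc _ (ltn_ord i) Pi => e; move: (ltn_ord i); rewrite e ltnNge cn.
Qed.

Lemma ndvdz_lt (n k : nat) : (0 < k < n)%N -> (n%:Z %| k%:Z)%Z = false.
Proof. by case/andP=> k0 kn; apply: gtnNdvd. Qed.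

(** * Quadratic Gauss sums *)

Section GaussNorm.
Variable R : realType.
Local Notation gaussC := (@gaussC R).
Local Notation gaussS := (@gaussS R).
Local Notation zcos := (@zcos R).
Local Notation zsin := (@zsin R).

(** Expand |G|^2 as a double sum over x and y and put x = y + h: the phase becomes linear in y, so
    the sum over y vanishes unless n divides 2 a h. *)
Lemma gauss_norm (n : nat) (a : int) : (0 < n)%N ->
  gaussC a n ^+ 2 + gaussS a n ^+ 2 =
  \sum_(h < n) zcos n (a * h%:Z ^+ 2) * (if (n%:Z %| 2 * a * h%:Z)%Z then n%:R else 0).
Proof.
move=> n0.
have per y : zperiodic n (fun x => zcos n (a * x ^+ 2 - a * y ^+ 2)).
  move=> x; apply: (zperiodic_eq (zcos_periodic R n0)); apply/dvdzP.
  by exists (a * (2 * x + n%:Z)); ring.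
transitivity (\sum_(y < n) \sum_(x < n) zcos n (a * x%:Z ^+ 2 - a * y%:Z ^+ 2)).
  under [RHS]eq_bigr => y _.
    under eq_bigr => x _ do rewrite zcosB.
    rewrite big_split /= -!mulr_suml. over.
  by rewrite big_split /= -!mulr_sumr -!expr2.
under eq_bigr => y _.
  rewrite -(sum_shift y n0 (per y)).
  under eq_bigr => h _.
    rewrite (_ : _ - _ = a * h%:Z ^+ 2 + (2 * a * h%:Z) * y%:Z) ?zcosD; last by ring.
    over.
  over.
rewrite exchange_big /=; apply: eq_bigr => h _.
have [eC eS] := sum_waves R (2 * a * h%:Z) n0.
by rewrite big_split /= sumrN -!mulr_sumr eC eS mulr0 subr0.
Qed.

(** Only h = 0 and, for even n, h = n / 2 survive, each contributing at most n. *)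
Lemma gauss_norm_le (n : nat) (a : int) : (0 < n)%N -> coprimez n a ->
  gaussC a n ^+ 2 + gaussS a n ^+ 2 <= 2 * n%:R.
Proof.
move=> n0 na; rewrite gauss_norm //.
have -> : 2 * n%:R = n%:R + n%:R :> R by ring.
apply: (@le_trans _ R (\sum_(h < n) (((h == 0 :> nat)%:R + (2 * h == n)%N%:R) * n%:R : R))).
  apply: ler_sum => h _; rewrite (mulrC 2 a) -(mulrA a) Gauss_dvdzr //.
  case: ifPn => [hn|_]; last first.
    by rewrite mulr0 mulr_ge0 // addr_ge0.
  apply: ler_wpM2r => //; apply: (@le_trans _ _ 1); first exact: cos_le1.
  have : (0 < (h == 0 :> nat) + (2 * h == n)%N)%N.
    move: hn => /dvdzP[q e]; have hn := ltn_ord h.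
    have [q0|q1] : q = 0 \/ q = 1.
      have q2 : q < 2 by nia.
      have q0 : -1 < q by nia.
      lia.
      by move: e; rewrite q0 mul0r; lia.
    by move: e; rewrite q1 mul1r; lia.
  by rewrite -natrD ler1n.
rewrite -mulr_suml big_split /= mulrDl.
apply: lerD; rewrite -{2}(mul1r n%:R) ler_wpM2r //.
  by apply: (sum_indicator_le1 _ (P := fun h => h == 0%N) (c := 0%N)) => h _ /eqP.
apply: (sum_indicator_le1 _ (P := fun h => (2 * h == n)%N) (c := n./2)) => h _ /eqP <-.
by rewrite mul2n doubleK.
Qed.

End GaussNorm.

(* [zfold n z] represents the class of [z] in (Z/n)/{1,-1}, whose representatives
   are 0, ..., n./2. *)
Section Fold.
Variable R : realType.
Local Notation gaussC := (@gaussC R).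
Local Notation zcos := (@zcos R).
Local Notation zsin := (@zsin R).
Variable n : nat.
Hypothesis n0 : (0 < n)%N.
Local Notation N := n./2.+1.

Let nz0 : n%:Z != 0. Proof. by rewrite eqz_nat -lt0n. Qed.

Definition zfold (z : int) : 'I_N :=
  inord (minn `|(z %% n)%Z| (n - `|(z %% n)%Z|)).

Definition zeven (V : Type) (f : int -> V) := forall z, f (- z) = f z.

Lemma zfoldE (V : Type) (f : int -> V) z : zeven f -> zperiodic n f ->
  f (zfold z)%:Z = f z.
Proof.
move=> fe fp; have := modz_ge0 z nz0; have := ltz_pmod z (n0 : 0 < n%:Z).
have e : f z = f (z %% n)%Z.
  by rewrite -(zperiodicM (z %% n)%Z (z %/ n)%Z fp) addrC -divz_eq.
rewrite e /zfold; case: (z %% n)%Z => // r rn _ /=.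
have {}rn : (r < n)%N by rewrite -ltz_nat.
rewrite inordK; last by rewrite ltnS /minn; case: ifP; lia.
case: (leqP r (n - r)) => rr; first by [].
by rewrite -fe -(fp (- _)); congr f; rewrite -subzn ?(ltnW rn) //; ring.
Qed.

Lemma zfold_id (k : 'I_N) : zfold k%:Z = k.
Proof.
apply: val_inj; rewrite /zfold /=; have := ltn_ord k; rewrite ltnS => kN.
have [kn|kn] := ltnP k n; last first.
  have : n = 0%N by lia.
  by lia.
rewrite modz_nat modn_small //= inordK; rewrite (minn_idPl _) //; lia.
Qed.

Lemma fold_repr_inj (j l : 'I_N) :
  (n%:Z %| j%:Z - l%:Z)%Z || (n%:Z %| j%:Z + l%:Z)%Z -> j = l.
Proof.
have := ltn_ord j; have := ltn_ord l; rewrite !ltnS => ln jn.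
case/orP => /dvdzP[q e]; apply: val_inj => /=.
  have : q = 0 by nia.
  by move=> q0; move: e; rewrite q0 mul0r; lia.
have [q0|[q1|qq]] : q = 0 \/ q = 1 \/ (2 <= q \/ q <= -1) by lia.
- by move: e; rewrite q0 mul0r; lia.
- by move: e; rewrite q1 mul1r; lia.
- nia.
Qed.

Lemma zfold_eq z w : zfold z = zfold w ->
  (n%:Z %| z - w)%Z || (n%:Z %| z + w)%Z.
Proof.
pose f x := (n%:Z %| x - w)%Z || (n%:Z %| x + w)%Z.
have fe : zeven f.
  move=> x; rewrite /f orbC; congr (_ || _).
    by rewrite -dvdz_opp opprD opprK.
  by rewrite -dvdz_opp opprD !opprK.
have fp : zperiodic n f.
  move=> x; rewrite /f; congr (_ || _).
    by rewrite -addrA [n%:Z + _]addrC addrA dvdz_addl.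
  by rewrite -addrA [n%:Z + _]addrC addrA dvdz_addl.
move=> e; rewrite -/(f z) -(zfoldE z fe fp) e zfoldE //.
by rewrite /f subrr dvdz0.
Qed.

Definition fold_weight (k : 'I_N) : nat := #|[set x : 'I_n | zfold x%:Z == k]|.

Lemma sum_fold (f : int -> R) : zeven f -> zperiodic n f ->
  \sum_(x < n) f x%:Z = \sum_(k < N) (fold_weight k)%:R * f k%:Z.
Proof.
move=> fe fp; rewrite (partition_big (fun x : 'I_n => zfold x%:Z) xpredT) //=.
apply: eq_bigr => k _; rewrite mulr_natl -sumr_const.
apply: eq_big => [x|x /eqP xk]; first by rewrite inE.
by rewrite -(zfoldE _ fe fp) xk.
Qed.

Lemma fold_weight_gt0 k : (0 < fold_weight k)%N.
Proof.
apply/card_gt0P; have kn : (k < n)%N by have := ltn_ord k; lia.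
by exists (Ordinal kn); rewrite inE /= zfold_id.
Qed.

(** A class has two elements unless it is its own opposite. Proved by summing the indicators of l
    and of -l over Z/n, directly and by classes. *)
Lemma fold_weight_eq (l : 'I_N) :
  (fold_weight l)%:R * (1 + (n%:Z %| l%:Z + l%:Z)%Z%:R) = 2 :> R.
Proof.
pose d (x : int) : R := (n%:Z %| x)%Z%:R.
have dp : zperiodic n d by move=> x; rewrite /d dvdz_addl.
have dsum : \sum_(x < n) d x%:Z = 1.
  rewrite /d; case: n n0 => // n' _; rewrite big_ord_recl (dvdz0 n'.+1) big1 ?addr0 //.
  by move=> i _; rewrite ndvdz_lt //= ltnS.
pose f x := d (x - l%:Z) + d (x + l%:Z).
have fe : zeven f.
  move=> x; rewrite /f addrC /d; congr (_%:R + _%:R).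
    by rewrite -dvdz_opp opprD opprK.
  by rewrite -dvdz_opp opprD !opprK.
have fp : zperiodic n f.
  by move=> x; rewrite /f -!addrA ![n%:Z + _]addrC !addrA !dp.
have := sum_fold fe fp.
rewrite {1}/f big_split /= !(sum_shift _ n0 dp) dsum (bigD1 l) //= big1 ?addr0.
  by move=> e; rewrite -[2]/(1 + 1) e /f subrr /d dvdz0.
move=> k kl; rewrite /f /d.
case: (boolP (n%:Z %| k%:Z - l%:Z)%Z) => [h|_].
  by case/eqP: kl; apply: fold_repr_inj; rewrite h.
case: (boolP (n%:Z %| k%:Z + l%:Z)%Z) => [h|_].
  by case/eqP: kl; apply: fold_repr_inj; rewrite h orbT.
by rewrite addr0 mulr0.
Qed.

(** The operator taking f to the sum over x of cos(2 pi a j x / n) f(x), on even functions on Z/n;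
    summing by classes puts the class sizes into the columns. *)
Definition cos_mx (a : int) : 'M[R]_N :=
  \matrix_(j, k) ((fold_weight k)%:R * zcos n (a * j%:Z * k%:Z)).

Lemma zcos_mul_even a : zeven (fun z => zcos n (a * z)).
Proof. by move=> z; rewrite mulrN zcosN. Qed.

Lemma zcos_mul_periodic a : zperiodic n (fun z => zcos n (a * z)).
Proof. by move=> z; rewrite mulrDr zperiodicM //; exact: zcos_periodic. Qed.

Lemma trace_cos_mx a : \tr (cos_mx a) = gaussC a n.
Proof.
rewrite /gaussC (@sum_fold (fun x => zcos n (a * x ^+ 2))).
- by apply: eq_bigr => k _; rewrite mxE -mulrA expr2.
- by move=> z; rewrite sqrrN.
- exact/zperiodic_sq/zcos_periodic.
Qed.

(** Product-to-sum leaves two wave sums, nonzero only for j = l and for j = -l modulo n. When both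
    survive, the weight of l is 1 instead of 2. *)
Lemma cos_mx_sqr a : coprimez n a -> cos_mx a *m cos_mx a = n%:R%:M.
Proof.
move=> na; apply/matrixP => j l; rewrite !mxE.
have nD : (2 : R) != 0 by rewrite pnatr_eq0.
transitivity ((fold_weight l)%:R *
   \sum_(x < n) (zcos n (a * (j%:Z - l%:Z) * x%:Z) + zcos n (a * (j%:Z + l%:Z) * x%:Z)) / 2).
  rewrite (@sum_fold (fun x =>
    (zcos n (a * (j%:Z - l%:Z) * x) + zcos n (a * (j%:Z + l%:Z) * x)) / 2)).
  - rewrite mulr_sumr; apply: eq_bigr => k _; rewrite !mxE.
    rewrite (_ : a * (j%:Z - l%:Z) * k%:Z = a * j%:Z * k%:Z - a * k%:Z * l%:Z); last by ring.
    rewrite (_ : a * (j%:Z + l%:Z) * k%:Z = a * j%:Z * k%:Z + a * k%:Z * l%:Z); last by ring.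
    by rewrite zcosB zcosD; field.
  - by move=> z; rewrite !zcos_mul_even.
  - by move=> z; rewrite !zcos_mul_periodic.
rewrite -mulr_suml big_split /=.
have [-> _] := sum_waves R (a * (j%:Z - l%:Z)) n0.
have [-> _] := sum_waves R (a * (j%:Z + l%:Z)) n0.
rewrite !Gauss_dvdzr //.
have [->|jl] := eqVneq j l.
  rewrite subrr dvdz0 mulr1n; apply: (mulfI nD).
  by rewrite -[2 in RHS](fold_weight_eq l); case: ifP => _ /=; field.
case: ifP => h; first by case/eqP: jl; apply: fold_repr_inj; rewrite h.
case: ifP => h'; first by case/eqP: jl; apply: fold_repr_inj; rewrite h' orbT.
by rewrite addr0 mul0r mulr0.
Qed.

(* Multiplying the class of [j] by [a] permutes Z/n up to sign, so
   [cos_mx (a * c)] is [cos_mx c] with its rows permuted, independently of [c]. *)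
Lemma det_cos_mxM a b : coprimez n a ->
  \det (cos_mx (a * b)) * \det (cos_mx 1) = \det (cos_mx a) * \det (cos_mx b).
Proof.
move=> na; pose g (j : 'I_N) := zfold (a * j%:Z).
have ginj : injective g.
  move=> j l /zfold_eq; rewrite -mulrBr -mulrDr !Gauss_dvdzr //.
  exact: fold_repr_inj.
have row c : cos_mx (a * c) = perm_mx (perm ginj) *m cos_mx c.
  rewrite -row_permE; apply/matrixP=> j k; rewrite !mxE permE; congr (_ * _).
  rewrite (_ : a * c * j%:Z * k%:Z = (c * k%:Z) * (a * j%:Z)); last by ring.
  rewrite -(zfoldE (a * j%:Z) (zcos_mul_even (c * k%:Z)) (zcos_mul_periodic (c * k%:Z))).
  by rewrite mulrAC.
have := row 1; rewrite mulr1 => ->; rewrite row !det_mulmx.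
by rewrite mulrAC.
Qed.

(** Column k lists the Chebyshev polynomials at cos(2 pi k / n), up to a positive weight, and these
    cosines decrease because the angles stay within [0, pi]. *)
Lemma sg_det_cos_mx1 : Num.sg (\det (cos_mx 1)) = (-1) ^+ 'C(N, 2).
Proof.
pose c (k : 'I_N) := cos (2 * pi * k%:R / n%:R) : R.
have -> : cos_mx 1 = (\matrix_(j < N, k < N) (chebyshev 'X j).[c k]) *m
   diag_mx (\row_k (fold_weight k)%:R).
  apply/matrixP=> j k; rewrite mul_mx_diag !mxE mulrC; congr (_ * _).
  rewrite /c -cos_chebyshev /zcos mul1r intrM; congr cos.
  by rewrite !mulrA; congr (_ / _); ring.
rewrite det_mulmx det_diag sgrM [X in _ * X]gtr0_sg; last first.
  by apply: prodr_gt0 => k _; rewrite mxE ltr0n fold_weight_gt0.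
rewrite mulr1; apply: sgdet_poly_decreasing.
- by move=> j; case: (@size_lead_chebyshev R 'X j); rewrite ?size_polyX ?lead_coefX.
- by move=> j; case: (@size_lead_chebyshev R 'X j); rewrite ?size_polyX ?lead_coefX.
have nR : (0 : R) < n%:R by rewrite ltr0n.
have pi0 := pi_gt0 R.
have mem (k : 'I_N) : (2 * pi * k%:R / n%:R : R) \in `[0, pi].
  rewrite in_itv /=; apply/andP; split.
    by rewrite divr_ge0 ?mulr_ge0 // ltW.
  rewrite ler_pdivrMr // mulrAC mulrC ler_pM2l //.
  by rewrite -natrM ler_nat; have := ltn_ord k; lia.
move=> j k jk; rewrite ltr_cos // ltr_pM2r ?invr_gt0 // ltr_pM2l ?mulr_gt0 //.
by rewrite ltr_nat.
Qed.
End Fold.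

Lemma coprimez1 (n : int) : coprimez n 1.
Proof. by rewrite coprimezE coprimen1. Qed.

(** * From determinant signs to values of Gauss sums *)

Section GaussValues.
Variable R : realType.
Local Notation gaussC := (@gaussC R).
Local Notation gaussS := (@gaussS R).
Local Notation zcos := (@zcos R).
Local Notation zsin := (@zsin R).

Lemma odd_bin2 (N : nat) : odd 'C(N, 2) = odd N./2.
Proof.
rewrite bin2; have [q [->|->]] : exists q, N = q.*2 \/ N = q.*2.+1.
- by exists N./2; lia.
- case: q => // q; rewrite doubleK (_ : (q.+1.*2 * q.+1.*2.-1)./2 = q.+1 * q.*2.+1)%N.
    by rewrite oddM /= odd_double /= andbT.
  by rewrite -doubleMl doubleK.
- rewrite /= (_ : (q.*2.+1 * q.*2)./2 = q.*2.+1 * q)%N; last by rewrite -doubleMr doubleK.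
  by rewrite oddM /= odd_double uphalf_double.
Qed.

(* The sign [(-1) ^+ m] determines [N - 2 m] modulo 4, hence exactly, since
   [`|N - 2 m| <= 1] by the bound on [v]. *)
Lemma trace_of_det_sign (n N m : nat) (v : R) : (0 < n)%N ->
  v = Num.sqrt n%:R * (N%:R - 2 * m%:R) -> v ^+ 2 <= 2 * n%:R ->
  v = if odd N then Num.sqrt n%:R * ((-1) ^+ m * (-1) ^+ 'C(N, 2)) else 0.
Proof.
move=> n0 ->; have nR : (0 : R) < n%:R by rewrite ltr0n.
rewrite exprMn sqr_sqrtr ?ler0n // [_ * _ ^+ 2]mulrC ler_pM2r // => h.
have {}h : (N%:Z - 2 * m%:Z) ^+ 2 <= 2 :> int.
  by rewrite -(ler_int R) rmorphXn /= intrB intrM.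
have [h1 h2] : N%:Z - 2 * m%:Z < 2 /\ -2 < N%:Z - 2 * m%:Z by split; nia.
have -> : (-1) ^+ m * (-1) ^+ 'C(N, 2) = (-1) ^+ (m + N./2) :> R.
  by rewrite exprD -(signr_odd _ 'C(N, 2)) odd_bin2 signr_odd.
case: ifP => oN; last first.
  have -> : N = (2 * m)%N by lia.
  by rewrite natrM subrr mulr0.
congr (_ * _); rewrite -signr_odd.
have [e|e] : N = (2 * m).+1 \/ (2 * m = N.+1)%N by lia.
  have -> : odd (m + N./2) = false by lia.
  by rewrite e -natr1 natrM addrAC subrr add0r.
have -> : odd (m + N./2) by lia.
by rewrite -natrM e -natr1 opprD addrA subrr add0r expr1.
Qed.

(** The condition on [n./2.+1], the size of the matrix, says that n is 0 or 1 modulo 4. The sign of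
    [\det (cos_mx R n 1)] stands for the Vandermonde sign, so that the case a = 1 is immediate. *)
Lemma gaussC_det (n : nat) (a : int) : (0 < n)%N -> coprimez n a ->
  gaussC a n = if odd n./2.+1
    then Num.sqrt n%:R * (Num.sg (\det (cos_mx R n a)) * Num.sg (\det (cos_mx R n 1)))
    else 0.
Proof.
move=> n0 na; have nR : (0 : R) < n%:R by rewrite ltr0n.
have [m [tr sg]] := scaled_involution nR (cos_mx_sqr R n0 na).
rewrite sg_det_cos_mx1 // sg; apply: trace_of_det_sign => //.
  by rewrite -trace_cos_mx.
apply: le_trans (gauss_norm_le R n0 na).
by rewrite lerDl sqr_ge0.
Qed.

Lemma gaussC1 (n : nat) : (0 < n)%N ->
  gaussC 1 n = if odd n./2.+1 then Num.sqrt n%:R else 0.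
Proof.
move=> n0; rewrite gaussC_det ?coprimez1 //; case: ifP => // _.
by rewrite sg_det_cos_mx1 // -expr2 sqrr_sign mulr1.
Qed.

(** Take signs in [det_cos_mxM]: Re G(a; n) / sqrt(n) is multiplicative in a. *)
Lemma gaussCM (n : nat) (a b : int) : (0 < n)%N -> odd n./2.+1 ->
  coprimez n a -> coprimez n b ->
  gaussC (a * b) n * Num.sqrt n%:R = gaussC a n * gaussC b n.
Proof.
move=> n0 on na nb; rewrite !gaussC_det ?coprimezMr ?na // on.
have := congr1 Num.sg (det_cos_mxM R n0 b na); rewrite !sgrM => e.
have s1 : Num.sg (\det (cos_mx R n 1)) * Num.sg (\det (cos_mx R n 1)) = 1.
  by rewrite sg_det_cos_mx1 // -expr2 sqrr_sign.
by rewrite e -[LHS]mulr1 -s1; ring.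
Qed.

Lemma gaussC_sqr (n : nat) (a : int) : (0 < n)%N -> odd n./2.+1 ->
  coprimez n a -> gaussC a n ^+ 2 = n%:R.
Proof.
move=> n0 on na; rewrite gaussC_det // on exprMn sqr_sqrtr ?ler0n //.
rewrite exprMn !sqr_sg.
have nR : (n%:R : R) != 0 by rewrite pnatr_eq0 -lt0n.
have det0 c : coprimez n c -> \det (cos_mx R n c) != 0.
  move=> nc; have := congr1 determinant (cos_mx_sqr R n0 nc).
  rewrite det_mulmx det_scalar => e; apply/eqP => e0; move/eqP: e.
  by rewrite e0 mul0r eq_sym expf_eq0 (negbTE nR) andbF.
by rewrite !det0 ?coprimez1 // !mulr1.
Qed.

Lemma fold_weight_mul2 (n : nat) (n0 : (0 < n)%N) (f : int -> R) (k : 'I_n./2.+1) :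
  (forall x : int, (n%:Z %| x + x)%Z -> f x = 0) ->
  (fold_weight k)%:R * f k%:Z = 2 * f k%:Z.
Proof.
move=> f0; have := fold_weight_eq R n0 k.
case: (boolP (n%:Z %| k%:Z + k%:Z)%Z) => [/f0 ->|_]; first by rewrite !mulr0.
by rewrite addr0 mulr1 => ->.
Qed.

(** The self-opposite classes, 0 and possibly n / 2, contribute nothing; the others are represented
    by 1, ..., [n.-1./2] and have two elements each. *)
Lemma sum_fold_interior (n : nat) (f : int -> R) : (0 < n)%N ->
  zeven f -> zperiodic n f -> (forall x : int, (n%:Z %| x + x)%Z -> f x = 0) ->
  \sum_(x < n) f x%:Z = \sum_(k < n.-1./2) 2 * f k.+1%:Z.
Proof.
move=> n0 fe fp f0; rewrite (sum_fold n0 fe fp).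
under eq_bigr => k _ do rewrite fold_weight_mul2 //.
rewrite big_ord_recl /= (f0 0) ?dvdz0 // mulr0 add0r.
have [e|e] : (n./2 = n.-1./2 \/ n./2 = n.-1./2.+1 /\ n = n./2.*2)%N by lia.
  by rewrite e; apply: eq_bigr => k _; rewrite /bump /= add1n.
case: e => e1 e2; rewrite e1 big_ord_recr /= [X in _ + X](_ : _ = 0) ?addr0; last first.
  rewrite f0 ?mulr0 // /bump /= add1n -e1 -PoszD addnn -e2; exact: dvdzz.
by apply: eq_bigr => k _; rewrite /bump /= add1n.
Qed.

(** The analogue of [cos_mx] for odd functions, which vanish on self-opposite classes: indices start
    at 1 and every weight is 2. *)
Definition sin_mx (n : nat) : 'M[R]_(n.-1./2) :=
  \matrix_(j, k) (2 * zsin n (j.+1%:Z * k.+1%:Z)).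

Lemma zsin_half n (x y : int) : (0 < n)%N -> (n%:Z %| x + x)%Z -> zsin n (y * x) = 0.
Proof.
move=> n0 nx; have : zsin n (y * x) = - zsin n (y * x).
  rewrite -zsinN; apply: (zperiodic_eq (zsin_periodic R n0)).
  by rewrite opprK -mulrDr dvdz_mull.
lra.
Qed.

Lemma trace_sin_mx n : (0 < n)%N -> \tr (sin_mx n) = gaussS 1 n.
Proof.
move=> n0; rewrite /gaussS (@sum_fold_interior _ (fun x => zsin n (1 * x ^+ 2))) //.
- by apply: eq_bigr => k _; rewrite mxE mul1r expr2.
- by move=> x; rewrite sqrrN.
- exact/zperiodic_sq/zsin_periodic.
- by move=> x nx; rewrite mul1r expr2; exact: zsin_half.
Qed.

Lemma sin_mx_sqr n : (0 < n)%N -> sin_mx n *m sin_mx n = n%:R%:M.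
Proof.
move=> n0; apply/matrixP => j l; rewrite !mxE.
have nD : (2 : R) != 0 by rewrite pnatr_eq0.
pose f (x : int) := 2 * (zsin n (j.+1%:Z * x) * zsin n (l.+1%:Z * x)).
transitivity (\sum_(x < n) f x%:Z).
  rewrite (@sum_fold_interior n f) //.
  - by apply: eq_bigr => k _; rewrite !mxE /f (mulrC l.+1%:Z); ring.
  - by move=> x; rewrite /f !mulrN !zsinN mulrNN.
  - by move=> x; rewrite /f !mulrDr !zperiodicM //; exact: zsin_periodic.
  - by move=> x nx; rewrite /f !zsin_half // !mulr0.
transitivity (\sum_(x < n) (zcos n ((j.+1%:Z - l.+1%:Z) * x%:Z)
                           - zcos n ((j.+1%:Z + l.+1%:Z) * x%:Z))).
  by apply: eq_bigr => x _; rewrite /f mulrBl [_ * x%:Z in X in _ - X]mulrDl zcosB zcosD; ring.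
rewrite sumrB; have [-> _] := sum_waves R (j.+1%:Z - l.+1%:Z) n0.
have [-> _] := sum_waves R (j.+1%:Z + l.+1%:Z) n0.
have := ltn_ord j; have := ltn_ord l => ln jn.
(* The sum of the two indices lies strictly between 0 and n, so the second wave sum vanishes. *)
rewrite -PoszD ndvdz_lt ?subr0; last by lia.
have [->|jl] := eqVneq j l; first by rewrite subrr dvdz0.
rewrite mulr0n; case: ifP => // /dvdzP[q e]; case/eqP: jl; apply: val_inj => /=.
have q1 : q < 1 by nia.
have q2 : -1 < q by nia.
have q0 : q = 0 by lia.
by move: e; rewrite q0 mul0r; lia.
Qed.

(** By sin((j + 1) t) = sin(t) U_j(cos t), where the factors sin(t) are positive and go into a
    diagonal matrix. *)
Lemma sg_det_sin_mx n : (0 < n)%N -> Num.sg (\det (sin_mx n)) = (-1) ^+ 'C(n.-1./2, 2).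
Proof.
move=> n0; pose t (k : 'I_(n.-1./2)) := 2 * pi * k.+1%:R / n%:R : R.
have nR : (0 : R) < n%:R by rewrite ltr0n.
have pi0 := pi_gt0 R.
have tlt k : 0 < t k < pi.
  rewrite /t; apply/andP; split.
    by rewrite divr_gt0 // !mulr_gt0 // ltr0n.
  rewrite ltr_pdivrMr // mulrAC mulrC ltr_pM2l //.
  by rewrite -natrM ltr_nat; have := ltn_ord k; lia.
have -> : sin_mx n =
   (\matrix_(j < n.-1./2, k < n.-1./2) (chebyshev (2 *: 'X) j).[cos (t k)]) *m
   diag_mx (\row_k (2 * sin (t k))).
  apply/matrixP=> j k; rewrite mul_mx_diag !mxE [RHS]mulrC -mulrA -sin_chebyshev.
  congr (_ * _).
  rewrite /t /zsin intrM; congr sin.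
  by rewrite !mulrA; congr (_ / _); ring.
rewrite det_mulmx det_diag sgrM [X in _ * X]gtr0_sg; last first.
  by apply: prodr_gt0 => k _; rewrite mxE mulr_gt0 // sin_gt0_pi.
have sz : size (2 *: 'X : {poly R}) = 2 by rewrite size_scale ?size_polyX // pnatr_eq0.
have lc : 0 < lead_coef (2 *: 'X : {poly R}) by rewrite lead_coefZ lead_coefX mulr1.
rewrite mulr1; apply: sgdet_poly_decreasing.
- by move=> j; case: (@size_lead_chebyshev R (2 *: 'X) j).
- by move=> j; case: (@size_lead_chebyshev R (2 *: 'X) j).
move=> j k jk; rewrite ltr_cos; last 2 first.
- by rewrite in_itv /=; have /andP[/ltW -> /ltW ->] := tlt j.
- by rewrite in_itv /=; have /andP[/ltW -> /ltW ->] := tlt k.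
by rewrite ltr_pM2r ?invr_gt0 // ltr_pM2l ?mulr_gt0 // ltr_nat.
Qed.

(** The size [n.-1./2] is odd exactly for n = 0, 3 modulo 4. With [gaussC1], G(1; n) / sqrt(n) is 1
    + i, 1, 0, i for n = 0, 1, 2, 3 modulo 4. *)
Lemma gaussS1 (n : nat) : (0 < n)%N ->
  gaussS 1 n = if odd n.-1./2 then Num.sqrt n%:R else 0.
Proof.
move=> n0; have nR : (0 : R) < n%:R by rewrite ltr0n.
have [m [tr sg]] := scaled_involution nR (sin_mx_sqr n0).
rewrite sg_det_sin_mx // in sg; rewrite trace_sin_mx // in tr.
have := trace_of_det_sign n0 tr; rewrite -sg -expr2 sqrr_sign mulr1; apply.
apply: le_trans (gauss_norm_le R n0 (coprimez1 n%:Z)).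
by rewrite lerDr sqr_ge0.
Qed.
End GaussValues.

(** * Gauss sums modulo an odd prime and the Legendre symbol *)

Section Legendre.
Variable R : realType.
Local Notation gaussC := (@gaussC R).
Local Notation gaussS := (@gaussS R).
Local Notation zcos := (@zcos R).
Local Notation zsin := (@zsin R).
Implicit Types (p : nat) (a b : int).

Lemma prime_dvdz_mul p a b : prime p -> (p%:Z %| a * b)%Z = (p%:Z %| a)%Z || (p%:Z %| b)%Z.
Proof. by move=> pp; rewrite !dvdzE abszM Euclid_dvdM. Qed.

Lemma prime_coprimez p a : prime p -> coprimez p a = ~~ (p%:Z %| a)%Z.
Proof. by move=> pp; rewrite coprimezE /= prime_coprime. Qed.

Definition square_mod p a := [exists x : 'I_p, (p %| (x : nat)%:Z ^+ 2 - a)%Z].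

Lemma square_modP p a : (0 < p)%N ->
  reflect (exists x : int, (p %| x ^+ 2 - a)%Z) (square_mod p a).
Proof.
move=> p0; apply: (iffP existsP) => [[x h]|[x h]]; first by exists x%:Z.
have pz0 : p%:Z != 0 by rewrite eqz_nat -lt0n.
have xp : (`|(x %% p)%Z| < p)%N by rewrite -ltz_nat gez0_abs ?modz_ge0 // ltz_pmod.
exists (Ordinal xp); rewrite /= gez0_abs ?modz_ge0 //.
have -> : (x %% p)%Z ^+ 2 - a = x ^+ 2 - a + p%:Z * ((x %/ p)%Z * (- x - (x %% p)%Z)).
  by move: (divz_eq x p); move: (x %/ p)%Z (x %% p)%Z => q r ->; ring.
by rewrite dvdz_addl // dvdz_mulr.
Qed.

(** If a = y^2 modulo p, the substitution of y x for x absorbs a. *)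
Lemma sum_sq_residue p a (f : int -> R) : prime p -> zperiodic p f ->
  ~~ (p%:Z %| a)%Z -> square_mod p a ->
  \sum_(x < p) f (a * x%:Z ^+ 2) = \sum_(x < p) f (x%:Z ^+ 2).
Proof.
move=> pp fp pa /existsP[y hy]; have p0 := prime_gt0 pp.
have py : coprimez p y.
  rewrite prime_coprimez //; apply: contra pa => h.
  by rewrite -dvdz_opp -(dvdz_addr _ (dvdz_mulr y h)) -expr2.
have fp2 : zperiodic p (fun x => f (x ^+ 2)).
  by move=> x; have := zperiodic_sq 1 fp x; rewrite !mul1r.
rewrite -(sum_unit p0 fp2 py); apply: eq_bigr => x _.
apply: (zperiodic_eq fp); rewrite exprMn -mulrBl dvdz_mulr //.
by rewrite -dvdz_opp opprB.
Qed.

Lemma sum_sq_odd p a (f : int -> R) : odd p -> zperiodic p f ->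
  \sum_(x < p) f (a * x%:Z ^+ 2) =
  f 0 + \sum_(k < p.-1./2) 2 * f (a * k.+1%:Z ^+ 2).
Proof.
move=> po fp; have p0 : (0 < p)%N by case: p po {fp}.
(* Subtracting f 0 makes the summand vanish on the class of 0, the only self-opposite one as p is
   odd. *)
pose g (x : int) := f (a * x ^+ 2) - f 0.
have ge : zeven g by move=> x; rewrite /g sqrrN.
have gp : zperiodic p g by move=> x; rewrite /g (zperiodic_sq a fp).
have g0 x : (p%:Z %| x + x)%Z -> g x = 0.
  move=> h; apply/eqP; rewrite subr_eq0; apply/eqP; apply: (zperiodic_eq fp).
  rewrite subr0 expr2; apply/dvdz_mull/dvdz_mulr.
  rewrite -(@Gauss_dvdzr _ 2); last by rewrite coprimezE /= coprime_sym coprime2n.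
  by rewrite mulrDl mul1r.
have := sum_fold_interior p0 ge gp g0; rewrite /g sumrB sumr_const card_ord.
under [X in _ = X -> _]eq_bigr => k _ do rewrite mulrBr.
rewrite sumrB sumr_const card_ord => /eqP; rewrite subr_eq => /eqP ->.
rewrite -addrA addrC; congr (_ + _).
have hp : p = (p.-1./2).*2.+1 by lia.
by move: (p.-1./2) hp => h ->; rewrite mulrSr -muln2 mulrnA -mulrnAr; ring.
Qed.

(** The residues 0, k^2 and a k^2, for 1 <= k <= (p - 1) / 2, form a complete system: there are p of
    them, and a nonresidue times a nonzero square is never a square. [None] indexes the residue
    0. *)
Lemma sum_sq_nonresidue p a (f : int -> R) : prime p -> odd p -> zperiodic p f ->
  ~~ (p%:Z %| a)%Z -> ~~ square_mod p a ->
  \sum_(x < p) f (a * x%:Z ^+ 2) + \sum_(x < p) f (x%:Z ^+ 2) =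
  2 * \sum_(x < p) f x%:Z.
Proof.
move=> pp po fp pa sqa; have p0 := prime_gt0 pp.
have -> : \sum_(x < p) f (x%:Z ^+ 2) = \sum_(x < p) f (1 * x%:Z ^+ 2).
  by apply: eq_bigr => x _; rewrite mul1r.
rewrite !sum_sq_odd //.
pose h (o : option ('I_(p.-1./2) * bool)) : int :=
  if o is Some (k, b) then (if b then a else 1) * k.+1%:Z ^+ 2 else 0.
have inj2 (k l : 'I_(p.-1./2)) : (p %| k.+1%:Z ^+ 2 - l.+1%:Z ^+ 2)%Z -> k = l.
  have := ltn_ord k; have := ltn_ord l => lp kp.
  rewrite subr_sqr prime_dvdz_mul // -PoszD ndvdz_lt ?orbF; last by lia.
  move=> /dvdzP[q e]; apply: val_inj => /=.
  have q1 : q < 1 by nia.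
  have q2 : -1 < q by nia.
  have q0 : q = 0 by lia.
  by move: e; rewrite q0 mul0r; lia.
have npk (k : 'I_(p.-1./2)) : ~~ (p %| k.+1%:Z)%Z.
  by rewrite ndvdz_lt //; have := ltn_ord k; lia.
have nz (b : bool) (k : 'I_(p.-1./2)) : ~~ (p %| (if b then a else 1) * k.+1%:Z ^+ 2)%Z.
  rewrite expr2 !prime_dvdz_mul // (negbTE (npk k)) !orbF.
  by case: b => //; rewrite ndvdz_lt // prime_gt1.
have sep (k l : 'I_(p.-1./2)) : ~~ (p %| a * k.+1%:Z ^+ 2 - l.+1%:Z ^+ 2)%Z.
  apply: contra sqa => pd; apply/square_modP => //.
  have pk : coprimez p k.+1%:Z by rewrite prime_coprimez.
  have /coprimezP[[u v] /= uv] := pk.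
  (* Here v inverts k + 1 modulo p, so this would be a square root of a. *)
  exists (l.+1%:Z * v).
  have -> : (l.+1%:Z * v) ^+ 2 - a =
     - v ^+ 2 * (a * k.+1%:Z ^+ 2 - l.+1%:Z ^+ 2) - a * (1 - (v * k.+1%:Z) ^+ 2) by ring.
  rewrite dvdz_addl ?dvdz_opp; first by rewrite dvdz_mull.
  rewrite -(expr1n _ 2) subr_sqr -[X in (X - _) * _]uv addrK.
  by rewrite (mulrC u) -!mulrA dvdz_mull // dvdz_mulr.
have hinj s t : (p%:Z %| h s - h t)%Z -> s = t.
  case: s t => [[k b]|] [[l c]|] //=.
  - case: b c => [] [].
    + rewrite -mulrBr prime_dvdz_mul // (negbTE pa) => /inj2 -> //.
    + by rewrite mul1r (negbTE (sep _ _)).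
    + by rewrite mul1r -dvdz_opp opprB (negbTE (sep _ _)).
    + by rewrite !mul1r => /inj2 ->.
  - by rewrite subr0 (negbTE (nz _ _)).
  - by rewrite sub0r dvdz_opp (negbTE (nz _ _)).
have := @sum_residues R p f _ h p0 fp.
rewrite card_option card_prod card_ord card_bool => <- //; last by lia.
rewrite (bigD1 None) //= (reindex_omap Some id) /=; last by case.
set S := \sum_(j | Some j == Some j) _.
have -> : S = \sum_(k < p.-1./2) \sum_(b : bool) f ((if b then a else 1) * k.+1%:Z ^+ 2).
  by rewrite /S pair_bigA /=; apply: eq_big => [[k b]|[k b] _] //=; rewrite eqxx.
under [X in _ = 2 * (_ + X)]eq_bigr => k _ do rewrite big_bool /=.
by rewrite big_split /= -!mulr_sumr; ring.
Qed.

(** For a nonresidue a, G(a b; p) + G(b; p) is twice a full sum of waves, hence 0. *)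
Lemma gauss_legendre p a b : prime p -> odd p -> ~~ (p%:Z %| a)%Z -> ~~ (p%:Z %| b)%Z ->
  gaussC (a * b) p = (legendre a p)%:~R * gaussC b p /\
  gaussS (a * b) p = (legendre a p)%:~R * gaussS b p.
Proof.
move=> pp po pa pb; have p0 := prime_gt0 pp.
have cp : zperiodic p (fun x => zcos p (b * x)).
  by move=> x; rewrite mulrDr zperiodicM //; exact: zcos_periodic.
have sp : zperiodic p (fun x => zsin p (b * x)).
  by move=> x; rewrite mulrDr zperiodicM //; exact: zsin_periodic.
have [] := sum_waves R b p0; rewrite (negbTE pb) => c0 s0.
have eC : gaussC (a * b) p = \sum_(x < p) zcos p (b * (a * x%:Z ^+ 2)).
  by apply: eq_bigr => x _; rewrite mulrA (mulrC b).
have eS : gaussS (a * b) p = \sum_(x < p) zsin p (b * (a * x%:Z ^+ 2)).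
  by apply: eq_bigr => x _; rewrite mulrA (mulrC b).
rewrite eC eS /legendre (negbTE pa); case: ifPn => sq.
  by rewrite !mul1r (sum_sq_residue pp cp pa sq) (sum_sq_residue pp sp pa sq).
rewrite !mulN1r; split.
  have := sum_sq_nonresidue pp po cp pa sq; rewrite c0 mulr0 => /eqP.
  by rewrite addr_eq0 => /eqP.
have := sum_sq_nonresidue pp po sp pa sq; rewrite s0 mulr0 => /eqP.
by rewrite addr_eq0 => /eqP.
Qed.

(** Squaring modulo p is not injective, as 1 and p - 1 have the same square, hence not surjective; a
    missed value is not 0, since 0 is a square. *)
Lemma exists_nonresidue p : prime p -> odd p ->
  exists2 a : int, ~~ (p%:Z %| a)%Z & ~~ square_mod p a.
Proof.
move=> pp po; have p0 := prime_gt0 pp; have p1 := prime_gt1 pp.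
have p2 : (2 < p)%N by case: p p1 po {pp p0} => [|[|[|]]].
have rlt (x : 'I_p) : ((x ^ 2) %% p < p)%N by rewrite ltn_mod.
pose f x : 'I_p := Ordinal (rlt x).
have : (#|codom f| < p)%N.
  have le : (#|codom f| <= p)%N by have := leq_image_card f predT; rewrite card_ord.
  rewrite ltn_neqAle le andbT; apply/negP => /eqP e; have /injectiveP finj : injectiveb f.
    apply/injectiveP => x y; apply: (@image_injP _ _ f predT _) => //.
    by rewrite e cardT size_enum_ord.
  have p1' : (p.-1 < p)%N by rewrite prednK.
  have := @finj (Ordinal p1) (Ordinal p1'); rewrite /f => h.
  have ne : Ordinal p1 <> Ordinal p1' by move=> /(congr1 (@nat_of_ord p)) /=; lia.
  apply/ne/h; clear h ne.
  apply: val_inj => /=; rewrite (_ : p.-1 ^ 2 = (p - 2) * p + 1 ^ 2)%N ?modnMDl //.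
  by nia.
move=> lt; have /subsetPn[t _ nt] : ~~ ('I_p \subset codom f).
  by apply: contraTN lt => /subset_leq_card; rewrite card_ord -leqNgt.
have tf x : f x != t by apply: contraNneq nt => <-; exact: codom_f.
exists t%:Z.
  have [t0|t0] := posnP t; last by rewrite ndvdz_lt // t0 /=.
  case/eqP: (tf (Ordinal p0)); apply: val_inj; rewrite /= mod0n t0 //.
apply/existsP => -[x]; rewrite -eqz_mod_dvd => /eqP.
rewrite expr2 -PoszM mulnn !modz_nat => -[e].
by case/eqP: (tf x); apply: val_inj => /=; rewrite e modn_small.
Qed.

End Legendre.

(** * The Kronecker character and its Gauss sum *)

(** In the second case [1 < m %% 4] says that m is 2 or 3 modulo 4; in the first, [1 < D] excludes
    the trivial character. *)
Definition fundamental_disc (D : nat) :=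
  (D %% 4 == 1)%N && (1 < D)%N && squarefree D \/
  exists m, [/\ D = (4 * m)%N, (1 < m %% 4)%N & squarefree m].

Lemma squarefree_prime (n p : nat) : (0 < n)%N -> squarefree n -> prime p -> ~~ (p ^ 2 %| n)%N.
Proof.
move=> n0 /forallP sf pp; apply/negP => pn.
have p1 := prime_gt1 pp.
have pn' : (p < n.+1)%N.
  by rewrite ltnS (leq_trans _ (dvdn_leq n0 pn)) // -{1}(expn1 p) leq_exp2l.
by have := sf (Ordinal pn'); rewrite /= pn /= => /eqP e; rewrite e in p1.
Qed.

Section Character.
Variable R : realType.
Local Notation gaussC := (@gaussC R).
Local Notation gaussS := (@gaussS R).
Local Notation zcos := (@zcos R).
Local Notation zsin := (@zsin R).

Lemma gaussC_mul_sq (n : nat) (a b : int) : (0 < n)%N -> coprimez n b ->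
  gaussC (a * b ^+ 2) n = gaussC a n.
Proof.
move=> n0 nb; rewrite /gaussC.
rewrite -(sum_unit n0 (zperiodic_sq a (zcos_periodic R n0)) nb).
by apply: eq_bigr => x _; rewrite exprMn -mulrA.
Qed.

Lemma legendre_sign (p : nat) (a : int) : ~~ (p%:Z %| a)%Z ->
  legendre a p = 1 \/ legendre a p = -1.
Proof. by rewrite /legendre => /negbTE ->; case: ifP; [left|right]. Qed.

Lemma sqrtM_nat (a b : nat) : Num.sqrt (a * b)%N%:R = Num.sqrt a%:R * Num.sqrt b%:R :> R.
Proof. by rewrite natrM sqrtrM ?ler0n. Qed.

(** In G(1; p D) = G(D; p) G(p; D) the first factor is (D/p) G(1; p), and G(1; p D), G(1; p) are
    known. G(1; p) is sqrt(p) or i sqrt(p) as p is 1 or 3 modulo 4, so the real, respectively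
    imaginary, part is compared. *)
Lemma gaussC_odd_prime (p D : nat) : prime p -> odd p -> coprime p D -> (0 < D)%N ->
  odd D./2.+1 -> gaussC p D = Num.sqrt D%:R * (legendre D p)%:~R.
Proof.
move=> pp po pD D0 oD; have p0 := prime_gt0 pp.
have [h1 h2] := gauss_crt R 1 p0 D0 pD; rewrite !mul1r in h1 h2.
have npD : ~~ (p%:Z %| D%:Z)%Z by rewrite -prime_coprimez.
have np1 : ~~ (p%:Z %| 1)%Z by rewrite ndvdz_lt // prime_gt1.
have [] := gauss_legendre R pp po npD np1; rewrite mulr1 => eC eS.
have pD0 : (0 < p * D)%N by rewrite muln_gt0 p0.
move: h1 h2; rewrite eC eS !gaussC1 // !gaussS1 //.
have sp : Num.sqrt p%:R != 0 :> R by rewrite sqrtr_eq0 -ltNge ltr0n.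
have ls : (legendre D p)%:~R * (legendre D p)%:~R = 1 :> R.
  by have [->|->] := legendre_sign npD; rewrite ?mulr1 // mulrNN mulr1.
have [p4|p4] : (p %% 4 = 1 \/ p %% 4 = 3)%N by lia.
  rewrite (_ : odd p./2.+1 = true); last by lia.
  rewrite (_ : odd p.-1./2 = false); last by lia.
  rewrite (_ : odd (p * D)./2.+1 = true); last first.
    have : (p * D = D %[mod 4])%N by rewrite -modnMml p4 mul1n.
    lia.
  rewrite sqrtM_nat mulr0 mul0r subr0 => h _; apply: (mulfI sp).
  by rewrite mulrA h -[LHS]mul1r -[X in X * _ = _]ls; ring.
rewrite (_ : odd p./2.+1 = false); last by lia.
rewrite (_ : odd p.-1./2 = true); last by lia.
rewrite (_ : odd (p * D).-1./2 = true); last first.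
  have : (p * D = 3 * D %[mod 4])%N by rewrite -modnMml p4.
  lia.
rewrite sqrtM_nat mulr0 !mul0r addr0 => _ h; apply: (mulfI sp).
by rewrite mulrA h -[LHS]mul1r -[X in X * _ = _]ls; ring.
Qed.

Lemma zcos8D4 (z : int) : zcos 8 (z + 4) = - zcos 8 z.
Proof.
by rewrite /zcos intrD -cosDpi; congr cos; field.
Qed.

Lemma zsin8D4 (z : int) : zsin 8 (z + 4) = - zsin 8 z.
Proof.
by rewrite /zsin intrD -sinDpi; congr sin; field.
Qed.

(* Modulo 8, [5 x^2] is [x^2 + 4] for [x] odd and [x^2] for [x] even. *)
Lemma gauss5_8 : gaussC 5 8 = - gaussC 1 8 /\ gaussS 5 8 = - gaussS 1 8.
Proof.
have key (f : int -> R) : (forall z, f (z + 4) = - f z) ->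
    \sum_(x < 8) f (5 * x%:Z ^+ 2) = - \sum_(x < 8) f (1 * x%:Z ^+ 2).
  move=> f4; have f8 k z : f (z + 8 * k%:Z) = f z.
    elim: k => [|k IH]; first by rewrite mulr0 addr0.
    rewrite -IH -[in RHS](opprK (f _)) -!f4; congr f; rewrite -natz -natr1 !natz; ring.
  rewrite !big_ord_recr !big_ord0 /= !mul1r.
  have e1 (z : int) (k : nat) : 5 * z = z + 4 + 8 * k%:Z -> f (5 * z) = - f z.
    by move=> ->; rewrite f8 f4.
  have e2 (z : int) (k : nat) : 5 * z = z + 8 * k%:Z -> f (5 * z) = f z.
    by move=> ->; rewrite f8.
  rewrite (e2 (0%:Z ^+ 2) 0%N) // (e1 (1%:Z ^+ 2) 0%N) // (e2 (2%:Z ^+ 2) 2%N) //.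
  rewrite (e1 (3%:Z ^+ 2) 4%N) // (e2 (4%:Z ^+ 2) 8%N) // (e1 (5%:Z ^+ 2) 12%N) //.
  rewrite (e2 (6%:Z ^+ 2) 18%N) // (e1 (7%:Z ^+ 2) 24%N) //.
  have -> : f (2%:Z ^+ 2) = - f (0%:Z ^+ 2) by rewrite -f4.
  have -> : f (4%:Z ^+ 2) = f (0%:Z ^+ 2) by rewrite -[RHS](f8 2%N).
  have -> : f (6%:Z ^+ 2) = - f (0%:Z ^+ 2) by rewrite -f4 -[RHS](f8 4%N).
  ring.
by split; apply: key; [exact: zcos8D4|exact: zsin8D4].
Qed.

(** G(1; 2) = 0 is useless, so 8 replaces the prime: G(1; 8 D) = G(D; 8) G(8; D), with Re G(8; D) =
    Re G(2; D). D is 1 or 5 modulo 8, and the unknown Im G(8; D) is eliminated between the two real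
    equations. *)
Lemma gaussC_two (D : nat) : (D %% 4 = 1)%N ->
  gaussC 2 D = Num.sqrt D%:R * (kronecker_prime D 2)%:~R.
Proof.
move=> D4; have D0 : (0 < D)%N by lia.
have c8 : coprime 8 D by rewrite (@coprime_pexpl 3 2) // coprime2n; lia.
have c2 : coprimez D 2 by rewrite coprimezE /= coprime_sym coprime2n; lia.
have [h1 h2] := gauss_crt R 1 (isT : (0 < 8)%N) D0 c8; rewrite !mul1r in h1 h2.
have eC2 : gaussC 8 D = gaussC 2 D.
  by rewrite -(gaussC_mul_sq 2 D0 c2).
have D8 : (D %% 8 = 1 \/ D %% 8 = 5)%N by lia.
have DD : (D%:Z %% 8)%Z = (D %% 8)%N by rewrite modz_nat.
have D2 : (2 %| D%:Z)%Z = false by apply/negbTE; rewrite dvdzE /= dvdn2; lia.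
rewrite /kronecker_prime /= D2 DD.
have s8 : Num.sqrt 8%:R != 0 :> R by rewrite sqrtr_eq0 -ltNge ltr0n.
have C18 : gaussC 1 8 = Num.sqrt 8%:R by rewrite gaussC1.
have S18 : gaussS 1 8 = Num.sqrt 8%:R by rewrite gaussS1.
have C1 : gaussC 1 (8 * D) = Num.sqrt 8%:R * Num.sqrt D%:R.
  by rewrite gaussC1 ?muln_gt0 // sqrtM_nat ifT //; lia.
have S1 : gaussS 1 (8 * D) = Num.sqrt 8%:R * Num.sqrt D%:R.
  by rewrite gaussS1 ?muln_gt0 // sqrtM_nat ifT //; lia.
rewrite C1 in h1; rewrite S1 in h2.
case: D8 => D8; rewrite D8 /=.
  have [eC eS] : gaussC D 8 = gaussC 1 8 /\ gaussS D 8 = gaussS 1 8.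
    by apply: gauss_eq_mod => //; rewrite -eqz_mod_dvd DD D8.
  rewrite eC eS C18 S18 eC2 -mulrBr in h1; rewrite eC eS C18 S18 eC2 -mulrDr in h2.
  by move/(mulfI s8): h1 => h1; move/(mulfI s8): h2 => h2; lra.
have [eC eS] : gaussC D 8 = gaussC 5 8 /\ gaussS D 8 = gaussS 5 8.
  by apply: gauss_eq_mod => //; rewrite -eqz_mod_dvd DD D8.
have [g1 g2] := gauss5_8.
rewrite eC eS g1 g2 C18 S18 eC2 !mulNr opprK addrC -mulrBr in h1.
rewrite eC eS g1 g2 C18 S18 eC2 !mulNr -opprD -mulrDr -mulrN in h2.
by move/(mulfI s8): h1 => h1; move/(mulfI s8): h2 => h2; rewrite mulrN1; lra.
Qed.

Variable D : nat.
Hypothesis fD : fundamental_disc D.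

Lemma fundamental_gt1 : (1 < D)%N.
Proof. by case: fD => [/andP[/andP[]]//|[m [-> m4 _]]]; lia. Qed.

Let D0 : (0 < D)%N. Proof. exact: ltnW fundamental_gt1. Qed.

Lemma fundamental_odd : odd D./2.+1.
Proof. by case: fD => [/andP[/andP[/eqP h _] _]|[m [-> m4 _]]]; lia. Qed.

Let oD := fundamental_odd.

Let sD0 : Num.sqrt D%:R != 0 :> R.
Proof. by rewrite sqrtr_eq0 -ltNge ltr0n. Qed.

Let sDD : Num.sqrt D%:R * Num.sqrt D%:R = D%:R :> R.
Proof. by rewrite -expr2 sqr_sqrtr ?ler0n. Qed.

Lemma gaussC_prime (p : nat) : prime p -> coprime p D ->
  gaussC p D = Num.sqrt D%:R * (kronecker_prime D p)%:~R.
Proof.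
move=> pp pD; have [p2|p2] := eqVneq p 2%N; last first.
  rewrite /kronecker_prime (negbTE p2); apply: gaussC_odd_prime => //.
  by have [/eqP|//] := even_prime pp; rewrite (negbTE p2).
rewrite p2 in pD *.
case: fD => [/andP[/andP[/eqP D4 _] _]|[m [Dm _ _]]]; first exact: gaussC_two.
by move: pD; rewrite Dm coprimeMr.
Qed.

Local Notation chi := (kronecker D%:Z).

Lemma kronecker_primesE (k : int) : k != 0 ->
  chi k = \prod_(p <- primes `|k|%N) kronecker_prime D p ^+ logn p `|k|%N.
Proof.
move=> k0; rewrite /kronecker (negbTE k0) /kronecker_unit andbF mul1r.
by rewrite prime_decompE big_map.
Qed.

(** Both Re G(k; D) / sqrt(D) and the symbol are multiplicative and even in k, and they agree at
    primes; induct on the factorization of |k|. *)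
Lemma kronecker_gauss (k : int) : coprimez D k ->
  gaussC k D = Num.sqrt D%:R * (chi k)%:~R.
Proof.
have [->|k0] := eqVneq k 0.
  by rewrite coprimezE /= /coprime gcdn0 => /eqP e; move: fundamental_gt1; rewrite e.
wlog kpos : k k0 / 0 < k => [H|] Dk.
  have [k1|k1] := ltP 0 k; first exact: H.
  have -> : gaussC k D = gaussC (- k) D.
    by apply: eq_bigr => x _; rewrite mulNr zcosN.
  have -> : chi k = chi (- k).
    by rewrite !kronecker_primesE ?oppr_eq0 // abszN.
  apply: H; rewrite ?oppr_eq0 ?coprimezN //.
  by rewrite oppr_gt0 lt_neqAle k0.
rewrite kronecker_primesE //.
have kE : k = \prod_(p <- primes `|k|%N) (p%:Z ^+ logn p `|k|%N).
  rewrite -[LHS]gtz0_abs // {1}[`|k|%N]prod_prime_decomp ?absz_gt0 //.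
  rewrite prime_decompE big_map /= (big_morph Posz PoszM (erefl _)).
  by apply: eq_bigr => p _; rewrite -!natz natrX.
have : all (fun p => prime p && coprime p D) (primes `|k|%N).
  apply/allP => p; rewrite mem_primes => /and3P[pp _ pk]; rewrite pp /=.
  by apply: coprime_dvdl pk _; rewrite coprime_sym; move: Dk; rewrite coprimezE.
suff H (e : nat -> nat) (s : seq nat) : all (fun p => prime p && coprime p D) s ->
    gaussC (\prod_(p <- s) (p%:Z ^+ e p)) D =
    Num.sqrt D%:R * (\prod_(p <- s) kronecker_prime D p ^+ e p)%:~R.
  by move=> /(H (logn^~ `|k|%N)) <-; rewrite {1}kE.
elim: s => [|p s IH] /=.
  by rewrite !big_nil gaussC1 // oD mulr1.
move=> /andP[/andP[pp pD] /[dup] sall /IH {}IH]; rewrite !big_cons.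
have cs : coprimez D (\prod_(q <- s) q%:Z ^+ e q).
  rewrite big_seq_cond; elim/big_ind: _ => [|x y cx cy|q /andP[qs _]].
  - exact: coprimez1.
  - by rewrite coprimezMr cx cy.
  have /andP[qq qD] := allP sall q qs.
  by rewrite coprimezXr // coprimezE /= coprime_sym.
have cp : coprimez D p by rewrite coprimezE /= coprime_sym.
elim: (e p) => [|i IHi]; first by rewrite !expr0 !mul1r.
rewrite !exprS -!mulrA; apply: (mulIf sD0); rewrite gaussCM //; last first.
  by rewrite coprimezMr cs coprimezXr.
rewrite IHi gaussC_prime // intrM; ring.
Qed.

Lemma kronecker_noncoprime (k : int) : ~~ coprimez D k -> chi k = 0.
Proof.
move=> nDk; have [->|k0] := eqVneq k 0.
  rewrite /kronecker eqxx; case: eqP => // e.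
  by move: fundamental_gt1; rewrite -[D]/(`|D|%N); lia.
have [p pp pg] : exists2 p, prime p & (p %| gcdn D `|k|)%N.
  exists (pdiv (gcdn D `|k|)); rewrite ?pdiv_dvd // pdiv_prime //.
  by rewrite ltn_neqAle gcdn_gt0 D0 andbT eq_sym; move: nDk; rewrite coprimezE.
move: pg; rewrite dvdn_gcd => /andP[pD pk].
have pk' : p \in primes `|k|%N by rewrite mem_primes pp absz_gt0 k0.
rewrite kronecker_primesE // (big_rem p) //=.
have -> : kronecker_prime D p = 0.
  have pDz : (p%:Z %| D%:Z)%Z by rewrite dvdzE.
  by rewrite /kronecker_prime /legendre; case: eqP pDz => [->|_] ->.
by rewrite expr0n -[logn _ _ == 0]negbK -lt0n logn_gt0 pk' mul0r.
Qed.

Lemma kroneckerN (k : int) : chi (- k) = chi k.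
Proof.
have [->|k0] := eqVneq k 0; first by rewrite oppr0.
by rewrite !kronecker_primesE ?oppr_eq0 // abszN.
Qed.

Definition rchi (k : int) : R := (chi k)%:~R.

Lemma rchi_gauss k : coprimez D k -> rchi k = gaussC k D / Num.sqrt D%:R.
Proof. by move=> Dk; rewrite kronecker_gauss // mulrC mulKf. Qed.

Lemma rchi_noncoprime k : ~~ coprimez D k -> rchi k = 0.
Proof. by move=> /kronecker_noncoprime; rewrite /rchi => ->. Qed.

Lemma rchi_even : zeven rchi.
Proof. by move=> k; rewrite /rchi kroneckerN. Qed.

Lemma coprimezD (n : nat) (k x : int) : (n%:Z %| x)%Z -> coprimez n (k + x) = coprimez n k.
Proof.
by move=> /dvdzP[q ->]; rewrite /coprimez [k + _]addrC gcdzMDl.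
Qed.

(** Invisible in the product over primes defining the symbol; the Gauss sum depends only on k modulo
    D. This is quadratic reciprocity in disguise. *)
Lemma rchi_periodic : zperiodic D rchi.
Proof.
move=> k; have e : coprimez D (k + D%:Z) = coprimez D k by rewrite coprimezD.
case: (boolP (coprimez D k)) => Dk; last first.
  by rewrite !rchi_noncoprime // e.
have h : (D%:Z %| k + D%:Z - k)%Z by rewrite addrAC subrr add0r.
by have [eC _] := gauss_eq_mod R D0 h; rewrite !rchi_gauss ?e // eC.
Qed.

Lemma rchiM (u k : int) : coprimez D u -> rchi (u * k) = rchi u * rchi k.
Proof.
move=> Du; case: (boolP (coprimez D k)) => Dk; last first.
  by rewrite (rchi_noncoprime Dk) mulr0 rchi_noncoprime // coprimezMr Du.
rewrite !rchi_gauss ?coprimezMr ?Du // mulf_div -gaussCM //.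
by field; rewrite sD0.
Qed.

Lemma rchi_sqr (u : int) : coprimez D u -> rchi u * rchi u = 1.
Proof.
move=> Du; rewrite rchi_gauss // mulf_div -expr2 gaussC_sqr // sDD divff //.
by rewrite pnatr_eq0 -lt0n.
Qed.

(** Write D = p e with p prime to e, and take v a nonresidue modulo p with v = 1 modulo e. Then G(v;
    D) = (v/p) G(1; D) = - G(1; D). *)
Lemma primitive_odd (p : nat) : prime p -> odd p -> (p %| D)%N ->
  exists2 v : int, coprimez D v & rchi v = -1 /\ (D%:Z %| p%:Z * (v - 1))%Z.
Proof.
move=> pp po pD; have p0 := prime_gt0 pp.
pose e := (D %/ p)%N; have De : D = (p * e)%N by rewrite mulnC divnK.
have e0 : (0 < e)%N by move: D0; rewrite De muln_gt0 => /andP[].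
have pe : coprime p e.
  rewrite prime_coprime //; apply/negP => pe.
  have p2D : (p ^ 2 %| D)%N by rewrite De expnS expn1 dvdn_pmul2l.
  case: fD => [/andP[/andP[_ D1] sf]|[m [Dm m4 sf]]].
    by have := squarefree_prime D0 sf pp; rewrite p2D.
  have m0 : (0 < m)%N by lia.
  have c : coprime (p ^ 2) 4.
    by rewrite (_ : 4 = 2 ^ 2)%N // coprime_pexpl // coprime_pexpr // coprimen2.
  move: p2D; rewrite Dm (Gauss_dvdr _ c) => h.
  by have := squarefree_prime m0 sf pp; rewrite h.
have [a npa sqa] := exists_nonresidue pp po.
have pez : coprimez p e by [].
have [v vp ve] : exists2 v : int, (p%:Z %| v - a)%Z & (e%:Z %| v - 1)%Z.
  exists (zchinese p e a 1); rewrite -eqz_mod_dvd; apply/eqP.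
    exact: zchinese_modl.
  exact: zchinese_modr.
have npv : ~~ (p%:Z %| v)%Z.
  apply: contra npa => h; rewrite -dvdz_opp -(dvdz_addr _ h) //.
have sqv : ~~ square_mod p v.
  apply: contra sqa => /square_modP[]// x h; apply/square_modP => //; exists x.
  by have -> : x ^+ 2 - a = x ^+ 2 - v + (v - a); [ring|rewrite dvdz_addl].
have Dv : coprimez D v.
  rewrite De PoszM coprimezMl prime_coprimez // npv /=.
  by rewrite -(subrK 1 v) addrC coprimezD // coprimez1.
exists v => //; split; last by rewrite De PoszM dvdz_mul.
have npe : ~~ (p%:Z %| e%:Z)%Z by rewrite -prime_coprimez.
rewrite rchi_gauss //; apply: (mulIf sD0); rewrite divfK // mulN1r.
have <- : gaussC 1 D = Num.sqrt D%:R by rewrite gaussC1 // oD.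
have [h1 _] := gauss_crt R 1 p0 e0 pe.
have [hv _] := gauss_crt R v p0 e0 pe.
rewrite De hv h1 !mul1r.
have [-> ->] := gauss_legendre R pp po npv npe.
have [-> ->] : gaussC (v * p) e = gaussC p e /\ gaussS (v * p) e = gaussS p e.
  apply: gauss_eq_mod => //; rewrite -[X in _ - X]mul1r -mulrBl.
  by rewrite dvdz_mulr.
have -> : legendre v p = -1.
  by rewrite /legendre (negbTE npv) -/(square_mod p v) (negbTE sqv).
by rewrite !mulN1r; ring.
Qed.

Lemma primitive_two : (2 %| D)%N ->
  exists2 v : int, coprimez D v & rchi v = -1 /\ (D%:Z %| 2 * (v - 1))%Z.
Proof.
(* For [D = 4 m] take [v = 1 + 2 m]: in [gaussC v D + gaussC 1 D] the odd terms
   cancel and the even ones add up to a multiple of [gaussC 1 m = 0]. *)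
move=> D2; case: fD => [/andP[/andP[/eqP D4 _] _]|[m [Dm m4 _]]].
  by move: D2; rewrite dvdn2; lia.
have m0 : (0 < m)%N by lia.
have c : coprimez D (1 + 2 * m%:Z).
  rewrite Dm PoszM coprimezMl; apply/andP; split; last first.
    by rewrite coprimezD ?coprimez1 // dvdz_mull.
  rewrite (_ : 4%:Z = 2 * 2) // coprimezMl andbb.
  by rewrite coprimezD ?coprimez1 // dvdz_mulr.
exists (1 + 2 * m%:Z) => //; split; last first.
  by apply/dvdzP; exists 1; rewrite Dm PoszM; ring.
rewrite rchi_gauss //; apply: (mulIf sD0); rewrite divfK // mulN1r.
have <- : gaussC 1 D = Num.sqrt D%:R by rewrite gaussC1 // oD.
apply/eqP; rewrite -addr_eq0; apply/eqP.
have m20 : (0 < 2 * m)%N by rewrite muln_gt0.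
have Dm' : D = (2 * (2 * m))%N by rewrite Dm mulnA.
pose f (z : int) := zcos D ((1 + 2 * m%:Z) * z ^+ 2) + zcos D (1 * z ^+ 2).
have fp : zperiodic (2 * (2 * m)) f.
  move=> z; rewrite -Dm' /f.
  by have h (a : int) := zperiodic_sq a (zcos_periodic R D0) z; rewrite !h.
rewrite /gaussC -big_split /= -/(f _).
transitivity (\sum_(x < D) f x%:Z); first by [].
rewrite -(big_mkord xpredT (fun x : nat => f x%:Z)) Dm' big_mkord.
rewrite -sum_classes // big_ord_recl big_ord1 /=.
rewrite [X in _ + X]big1 ?addr0; last first.
  move=> x _; rewrite /f /bump /=.
  set z := (_ + _ : int).
  have hz : (1 + 2 * m%:Z) * z ^+ 2 =
      (1 * z ^+ 2) + 2 * m%:Z + D%:Z * (2 * (x%:Z + x%:Z ^+ 2)).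
    by rewrite /z Dm PoszM; ring.
  have pD : zperiodic D (zcos D) := zcos_periodic R D0.
  have half w : zcos D (w + 2 * m%:Z) = - zcos D w.
    rewrite /zcos intrD -cosDpi; congr cos; rewrite Dm natrM intrM.
    by field; rewrite pnatr_eq0 -lt0n.
  by rewrite hz [D%:Z * _]mulrC zperiodicM // half addNr.
transitivity (\sum_(x < 2 * m) 2 * zcos m (1 * x%:Z ^+ 2)).
  apply: eq_bigr => x _; rewrite /f.
  have -> : zcos D ((1 + 2 * m%:Z) * (0%:Z + 2 * x%:Z) ^+ 2) = zcos D (4 * x%:Z ^+ 2).
    apply: (zperiodic_eq (zcos_periodic R D0)); apply/dvdzP; exists (2 * x%:Z ^+ 2).
    by rewrite Dm PoszM; ring.
  have -> : zcos D (1 * (0%:Z + 2 * x%:Z) ^+ 2) = zcos D (4 * x%:Z ^+ 2).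
    by congr zcos; ring.
  by rewrite {1 2}Dm zcos_scale // mul1r; ring.
rewrite -mulr_sumr (sum_periods _ m0 (zperiodic_sq 1 (zcos_periodic R m0))) //.
rewrite -/(gaussC 1 m) gaussC1 // (_ : odd m./2.+1 = false) ?mul0rn ?mulr0 //.
by lia.
Qed.

(** Primitivity in the form used for Gauss sums: v fixes k modulo D, yet chi(v) = -1. *)
Lemma rchi_primitive (k : int) : ~~ coprimez D k ->
  exists2 v : int, coprimez D v & rchi v = -1 /\ (D%:Z %| k * (v - 1))%Z.
Proof.
move=> nDk; have [p pp pg] : exists2 p, prime p & (p %| gcdn D `|k|)%N.
  exists (pdiv (gcdn D `|k|)); rewrite ?pdiv_dvd // pdiv_prime //.
  by rewrite ltn_neqAle gcdn_gt0 D0 andbT eq_sym; move: nDk; rewrite coprimezE.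
move: pg; rewrite dvdn_gcd => /andP[pD pk].
have [v Dv [rv dv]] : exists2 v : int, coprimez D v &
    rchi v = -1 /\ (D%:Z %| p%:Z * (v - 1))%Z.
  have [p2|po] := even_prime pp; last exact: primitive_odd.
  by rewrite p2 in pD *; exact: primitive_two.
exists v => //; split=> //; apply: (dvdz_trans dv).
by rewrite dvdz_mul // dvdzE.
Qed.

(** Unit substitutions give tau(k) = chi(k) tau(1), with primitivity for k not prime to D. To find
    tau(1), compute the sum of chi(u) Re G(u; D) over u in two ways: it is tau(1) phi and also
    sqrt(D) phi. *)
Lemma gauss_sum_rchi (k : int) :
  \sum_(u < D) rchi u%:Z * zcos D (k * u%:Z) = Num.sqrt D%:R * rchi k.
Proof.
pose tau (k : int) := \sum_(u < D) rchi u%:Z * zcos D (k * u%:Z).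
have per k' : zperiodic D (fun u => rchi u * zcos D (k' * u)).
  by move=> u; rewrite rchi_periodic mulrDr zperiodicM //; exact: zcos_periodic.
have tau0 k' : ~~ coprimez D k' -> tau k' = 0.
  move=> nDk; have [v Dv [rv dv]] := rchi_primitive nDk.
  have e : tau k' = - tau k'.
    (* Replacing u by v u flips the sign of chi and leaves the cosine unchanged. *)
    rewrite {1}/tau -(sum_unit D0 (per k') Dv) -mulN1r mulr_sumr.
    apply: eq_bigr => u _; rewrite rchiM // rv -mulrA; congr (_ * (_ * _)).
    apply: (zperiodic_eq (zcos_periodic R D0)).
    by have -> : k' * (v * u%:Z) - k' * u%:Z = k' * (v - 1) * u%:Z; [ring|rewrite dvdz_mulr].
  lra.
have tau1 k' : coprimez D k' -> tau k' = rchi k' * tau 1.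
  move=> Dk; rewrite /tau -(sum_unit D0 (per 1) Dk) mulr_sumr.
  apply: eq_bigr => u _; rewrite rchiM // mulrA mulrA rchi_sqr // !mul1r.
  by [].
suff t1 : tau 1 = Num.sqrt D%:R.
  rewrite -/(tau k); case: (boolP (coprimez D k)) => Dk.
    by rewrite tau1 // t1 mulrC.
  by rewrite tau0 // rchi_noncoprime // mulr0.
(* This counts the units modulo D; only phi != 0 is needed. *)
pose phi : R := \sum_(u < D) rchi u%:Z * rchi u%:Z.
have phi0 : phi != 0.
  rewrite gt_eqF // /phi (bigD1 (Ordinal fundamental_gt1)) //= rchi_sqr ?coprimez1 //.
  by rewrite ltr_pwDl // sumr_ge0 // => u _; rewrite -expr2 sqr_ge0.
apply: (mulIf phi0).
transitivity (\sum_(u < D) rchi u%:Z * gaussC u%:Z D).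
  transitivity (\sum_(x < D) tau (x%:Z ^+ 2)).
    rewrite /phi mulr_sumr; apply: eq_bigr => x _.
    case: (boolP (coprimez D x%:Z)) => Dx.
      rewrite (tau1 (x%:Z ^+ 2)); last exact: coprimezXr.
      by rewrite expr2 rchiM // mulrC.
    rewrite (rchi_noncoprime Dx) mulr0 mulr0 tau0 //.
    by rewrite coprimez_pexpr.
  rewrite /tau exchange_big /=; apply: eq_bigr => u _.
  by rewrite mulr_sumr; apply: eq_bigr => x _; rewrite mulrC (mulrC (x%:Z ^+ 2)) mulrC.
rewrite /phi mulr_sumr; apply: eq_bigr => u _.
case: (boolP (coprimez D u%:Z)) => Du.
  by rewrite kronecker_gauss // -/(rchi _); ring.
by rewrite rchi_noncoprime // !mul0r mulr0.
Qed.

End Character.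

(** * The triangle wave *)

Section Triangle.
Variable R : realType.
Local Notation zcos := (@zcos R).
Local Notation zsin := (@zsin R).

(** The mean value theorem gives y cos y <= sin y <= y. The upper bound amounts to y^2 - sin^2 y <=
    y^2 sin^2 y, that is, (y cos y)^2 <= sin^2 y. *)
Lemma inv_sin2_bounds (y : R) : 0 < y < pi / 2 ->
  0 <= (sin y ^+ 2)^-1 - (y ^+ 2)^-1 <= 1.
Proof.
case/andP=> y0 y2; have pi0 := pi_gt0 R.
have ypi : y < pi by lra.
have sy : 0 < sin y by rewrite sin_gt0_pi // y0.
have [|c] := @MVT R sin cos 0 y y0 (fun x _ => is_derive_sin x).
  exact/continuous_subspaceT/continuous_sin.
rewrite in_itv /= sin0 !subr0 => /andP[c0 cy] e.
have c1 : cos c <= 1 := cos_le1 c.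
have cc : cos y <= cos c.
  rewrite ltW // ltr_cos // in_itv /=; apply/andP; split; lra.
have cy0 : 0 < cos y by rewrite cos_gt0_pihalf //; apply/andP; split; lra.
have syy : sin y <= y by rewrite e ler_piMl // ltW.
have syc : y * cos y <= sin y by rewrite e mulrC ler_wpM2r // ltW.
have sc := cos2Dsin2 y.
have y20 : 0 < y ^+ 2 by rewrite exprn_gt0.
have s20 : 0 < sin y ^+ 2 by rewrite exprn_gt0.
have -> : (sin y ^+ 2)^-1 - (y ^+ 2)^-1 = (y ^+ 2 - sin y ^+ 2) / (sin y ^+ 2 * y ^+ 2).
  by field; rewrite !gt_eqF.
apply/andP; split.
  apply: divr_ge0; last by rewrite mulr_ge0 // ltW.
  rewrite subr_ge0.
  by rewrite ler_sqr // nnegrE ltW.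
rewrite ler_pdivrMr ?mulr_gt0 // mul1r.
have : (y * cos y) ^+ 2 <= sin y ^+ 2.
  by rewrite ler_sqr // nnegrE ?ltW // mulr_gt0.
rewrite exprMn; nra.
Qed.

Variable h : nat.
Hypothesis h0 : (0 < h)%N.
Local Notation M := (2 * h)%N.
Let M0 : (0 < M)%N. Proof. by rewrite muln_gt0. Qed.

Lemma zcos_odd_neq1 (l : nat) : 1 - zcos M l.*2.+1%:Z != 0.
Proof.
rewrite subr_eq0 eq_sym; apply/eqP => /(zcos_eq1 M0) /dvdzP[q e].
have : l.*2.+1%:Z = q * h%:Z * 2 by rewrite e PoszM; ring.
lia.
Qed.

(** The Fourier expansion of a triangle wave of period M; the denominators are 2 sin^2(pi k / M) for
    the odd frequencies k. *)
Definition triangle_sum (d : int) : R :=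
  \sum_(l < h) zcos M (l.*2.+1%:Z * d) / (1 - zcos M l.*2.+1%:Z).

Lemma sum_zcos_odd (d : int) : 
  \sum_(l < h) zcos M (l.*2.+1%:Z * d) = (if (h%:Z %| d)%Z then h%:R else 0) * zcos M d.
Proof.
have [eC eS] := sum_waves R d h0.
rewrite -eC.
transitivity (\sum_(l < h) (zcos h (d * l%:Z) * zcos M d - zsin h (d * l%:Z) * zsin M d)).
  apply: eq_bigr => l _.
  rewrite (_ : l.*2.+1%:Z * d = 2 * (d * l%:Z) + d); last first.
    by rewrite -(addn1 l.*2) -(muln2 l) PoszD PoszM; ring.
  by rewrite zcosD zcos_scale // zsin_scale.
by rewrite sumrB -!mulr_suml eS mul0r subr0.
Qed.

(** The second difference of cos(k t) cancels the denominator 1 - cos k, up to the factor -2, and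
    leaves a sum of odd waves that vanishes for 0 < d < h. *)
Lemma triangle_sum_step (d : nat) : (0 < d < h)%N ->
  triangle_sum d.+1 - triangle_sum d = triangle_sum d - triangle_sum d.-1.
Proof.
move=> /andP[d0 dh]; apply/eqP; rewrite -subr_eq0; apply/eqP.
transitivity (- 2 * \sum_(l < h) zcos M (l.*2.+1%:Z * d%:Z)).
  rewrite mulr_sumr /triangle_sum -!sumrB; apply: eq_bigr => l _.
  have k0 := zcos_odd_neq1 l.
  have -> : l.*2.+1%:Z * d.+1%:Z = l.*2.+1%:Z * d%:Z + l.*2.+1%:Z.
    by rewrite -(addn1 d) PoszD; ring.
  have -> : l.*2.+1%:Z * d.-1%:Z = l.*2.+1%:Z * d%:Z - l.*2.+1%:Z.
    by rewrite -{2}(prednK d0) -(addn1 d.-1) PoszD; ring.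
  by rewrite zcosD zcosB; field.
by rewrite sum_zcos_odd ndvdz_lt ?d0 // mul0r mulr0.
Qed.

(** Linear with slope -h on [0, h]; the constant follows from the antisymmetry
    [triangle_sum h = - triangle_sum 0], as odd waves change sign over half a period. *)
Lemma triangle_sumE (d : nat) : (d <= h)%N ->
  triangle_sum d = h%:R ^+ 2 / 2 - h%:R * d%:R.
Proof.
have slope e : (e < h)%N -> triangle_sum e.+1 - triangle_sum e = - h%:R.
  elim: e => [|e IH] eh; last first.
    by rewrite triangle_sum_step //= IH // ltnW.
  rewrite /triangle_sum -sumrB.
  transitivity (\sum_(l < h) (-1 : R)); last by rewrite sumr_const card_ord mulNrn.
  apply: eq_bigr => l _; rewrite mulr1 mulr0 zcos0.
  by have k0 := zcos_odd_neq1 l; field.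
have lin e : (e <= h)%N -> triangle_sum e = triangle_sum 0 - h%:R * e%:R.
  elim: e => [|e IH] eh; first by rewrite mulr0 subr0.
  have := slope e eh; rewrite (IH (ltnW eh)) -natr1 => /eqP.
  by rewrite subr_eq => /eqP ->; ring.
have fold_h : triangle_sum h = - triangle_sum 0.
  rewrite /triangle_sum -sumrN; apply: eq_bigr => l _.
  have -> : zcos M (l.*2.+1%:Z * h%:Z) = -1.
    rewrite -(addn1 l.*2) -(muln2 l) PoszD PoszM.
    rewrite (_ : _ * _ = h%:Z + l%:Z * M%:Z); last by rewrite PoszM; ring.
    rewrite zperiodicM; last exact: zcos_periodic.
    rewrite /zcos -[RHS]cospi; congr cos.
    by rewrite natrM; field; rewrite pnatr_eq0 -lt0n.
  by rewrite mulr0 zcos0 mulN1r mul1r.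
move=> dh; rewrite lin //; congr (_ - _).
have := lin h (leqnn h); rewrite fold_h => e.
have : 2 * triangle_sum 0 = h%:R ^+ 2 by lra.
by move=> <-; field.
Qed.

Lemma triangle_sum_even (d : int) : triangle_sum (M%:Z - d) = triangle_sum d.
Proof.
apply: eq_bigr => l _; congr (_ / _); rewrite mulrBr addrC.
by rewrite zperiodicM ?zcosN //; exact: zcos_periodic.
Qed.

End Triangle.

Lemma sum_palindrome (V : nmodType) (a : nat) (g : nat -> V) :
  (forall l, (l < a)%N -> g (a + a - l.+1)%N = g l) ->
  \sum_(l < a + a) g l = (\sum_(l < a) g l) *+ 2.
Proof.
move=> gp; rewrite big_split_ord /= mulr2n; congr (_ + _).
rewrite (reindex_inj rev_ord_inj) /=; apply: eq_bigr => l _.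
by rewrite -[RHS]gp //; congr g; have := ltn_ord l; lia.
Qed.

Definition circle_dist (D d : nat) : nat := minn d (D - d).

(** * The distance-weighted character sum and L(2, chi) *)

Section CharacterTriangle.
Variable R : realType.
Local Notation zcos := (@zcos R).
Local Notation zsin := (@zsin R).
Variable D : nat.
Hypothesis fD : fundamental_disc D.
Local Notation chi := (rchi R D).
Let D0 : (0 < D)%N. Proof. exact: ltnW (fundamental_gt1 fD). Qed.
Let DR : (0 : R) < D%:R. Proof. by rewrite ltr0n. Qed.

Definition chi_dist_sum : R := \sum_(d < D) (circle_dist D d)%:R * chi d%:Z.
Definition odd_sum (X : nat) : R := \sum_(l < X) chi l.*2.+1%:Z / l.*2.+1%:R ^+ 2.

Lemma rchi_norm_le1 (k : int) : `|chi k| <= 1.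
Proof.
case: (boolP (coprimez D k)) => Dk; last by rewrite rchi_noncoprime // normr0.
have := rchi_sqr R fD Dk; rewrite -expr2 => /eqP; rewrite sqrf_eq1.
by case/orP=> /eqP ->; rewrite ?normrN normr1.
Qed.

Lemma sum_rchi : \sum_(u < D) chi u%:Z = 0.
Proof.
have := gauss_sum_rchi R fD 0; rewrite (rchi_noncoprime R fD); last first.
  by rewrite coprimezE /= /coprime gcdn0 neq_ltn fundamental_gt1 // orbT.
rewrite mulr0 => e; rewrite -[RHS]e; apply: eq_bigr => u _.
by rewrite mul0r zcos0 mulr1.
Qed.

Section Level.
Variable i : nat.
Hypothesis i0 : (0 < i)%N.
(** Written as a sum so that [sum_palindrome] applies to the h odd frequencies below M = 4 i D. *)
Local Notation h := (i * D + i * D)%N.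
Local Notation M := (2 * h)%N.
Let h0 : (0 < h)%N. Proof. by rewrite addn_gt0 muln_gt0 i0 D0. Qed.
Let ME : M = (4 * i * D)%N. Proof. by rewrite addnn -mul2n !mulnA. Qed.

(** Multiplication by 4 i embeds Z/D into Z/M and scales ||d|| by 4 i; the image distance is at most
    h, where the wave is linear. *)
Lemma triangle_sum_dist (d : nat) : (d <= D)%N ->
  triangle_sum R h (4 * i%:Z * d%:Z) =
    h%:R ^+ 2 / 2 - h%:R * (4 * i%:R * (circle_dist D d)%:R).
Proof.
move=> dD; rewrite /circle_dist; have [hd|hd] := leqP d (D - d).
  rewrite (_ : 4 * i%:Z * d%:Z = (4 * i * d)%N%:Z) // triangle_sumE //.
    by rewrite !natrM.
  nia.
rewrite -triangle_sum_even // (_ : M%:Z - _ = (4 * i * (D - d))%N%:Z); last first.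
  by rewrite ME !PoszM -subzn //; ring.
rewrite triangle_sumE // ?natrM //.
have : (2 * (D - d) <= D)%N by lia.
nia.
Qed.

(** Expand the wave and exchange sums: the sum over d is a Gauss sum. The constant h^2 / 2 drops out
    since chi sums to 0. *)
Lemma chi_dist_sum_level :
  h%:R * (4 * i%:R * chi_dist_sum) =
  - Num.sqrt D%:R * \sum_(l < h) chi l.*2.+1%:Z / (1 - zcos M l.*2.+1%:Z).
Proof.
transitivity (- \sum_(d < D) chi d%:Z * triangle_sum R h (4 * i%:Z * d%:Z)).
  under eq_bigr => d _ do rewrite (triangle_sum_dist (ltnW (ltn_ord d))) mulrBr.
  rewrite sumrB -mulr_suml sum_rchi mul0r sub0r opprK /chi_dist_sum !mulr_sumr.
  by apply: eq_bigr => d _; ring.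
rewrite mulNr; congr (- _); rewrite mulr_sumr.
under eq_bigr => d _ do rewrite /triangle_sum mulr_sumr.
rewrite exchange_big /=; apply: eq_bigr => l _.
rewrite mulrA -gauss_sum_rchi // mulr_suml; apply: eq_bigr => d _.
rewrite mulrA; congr (_ * _ / _).
rewrite (_ : _ * (4 * _ * _) = (4 * i)%N%:Z * (l.*2.+1%:Z * d%:Z)); last first.
  by rewrite PoszM; ring.
by rewrite ME zcos_scale // muln_gt0.
Qed.

(** The odd frequencies k and M - k contribute equally, chi being even and D-periodic with D
    dividing M. *)
Lemma chi_dist_sum_half :
  chi_dist_sum = - (Num.sqrt D%:R / (4 * i%:R ^+ 2 * D%:R)) *
    \sum_(l < i * D) chi l.*2.+1%:Z / (1 - zcos M l.*2.+1%:Z).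
Proof.
have iR : (i%:R : R) != 0 by rewrite pnatr_eq0 -lt0n.
have hR : (h%:R : R) = 2 * i%:R * D%:R by rewrite natrD natrM; ring.
have DR0 : (D%:R : R) != 0 by rewrite gt_eqF.
have := chi_dist_sum_level.
rewrite (sum_palindrome (g := fun l => chi l.*2.+1%:Z / (1 - zcos M l.*2.+1%:Z)));
  last first.
  move=> l la.
  have -> : (i * D + i * D - l.+1).*2.+1%:Z = - l.*2.+1%:Z + 1 * M%:Z by lia.
  have Mp : zperiodic M (zcos M) by apply: zcos_periodic; rewrite muln_gt0.
  rewrite (zperiodicM _ _ Mp) zcosN; congr (_ / _).
  rewrite ME PoszM mulrA zperiodicM; last exact: rchi_periodic.
  exact: rchi_even.
set S := \sum_(l < i * D) _ => e.
apply: (mulfI (_ : h%:R * (4 * i%:R) != 0 :> R)).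
  by rewrite hR !mulf_neq0 // pnatr_eq0.
rewrite -[LHS]mulrA e hR mulr2n; field.
by rewrite DR0 iR.
Qed.

(** With y = pi k / M, the denominator is 2 sin^2 y. Replacing sin^2 y by y^2 gives the [odd_sum]
    term; each of the i D errors is at most 1/2 before the factor c. *)
Lemma chi_dist_sum_approx :
  `|chi_dist_sum + 2 * D%:R * Num.sqrt D%:R / pi ^+ 2 * odd_sum (i * D)| <=
  Num.sqrt D%:R / (8 * i%:R).
Proof.
have iR : (0 : R) < i%:R by rewrite ltr0n.
have pi0 := pi_gt0 R.
have sD : 0 <= Num.sqrt D%:R :> R by rewrite sqrtr_ge0.
pose c : R := Num.sqrt D%:R / (4 * i%:R ^+ 2 * D%:R).
have c0 : 0 <= c by rewrite divr_ge0 // !mulr_ge0 // ?exprn_ge0 // ltW.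
pose y (l : nat) : R := pi * l.*2.+1%:R / (4 * i%:R * D%:R).
have yb (l : 'I_(i * D)) : 0 < y l < pi / 2.
  rewrite /y; apply/andP; split.
    by rewrite divr_gt0 // ?mulr_gt0 // ltr0n.
  rewrite ltr_pdivrMr ?mulr_gt0 // -[ltRHS]mulrA ltr_pM2l //.
  rewrite (_ : 2^-1 * _ = (2 * (i * D))%:R); last by rewrite !natrM; field.
  by rewrite ltr_nat; have := ltn_ord l; lia.
have zc (l : nat) : 1 - zcos M l.*2.+1%:Z = 2 * sin (y l) ^+ 2.
  have -> : zcos M l.*2.+1%:Z = cos (y l *+ 2).
    rewrite /zcos /y ME !natrM; congr cos; rewrite -mulr_natl.
    by field; rewrite !gt_eqF.
  rewrite cos_mulr2n cos2sin2 -mulr_natl; ring.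
have -> : chi_dist_sum + 2 * D%:R * Num.sqrt D%:R / pi ^+ 2 * odd_sum (i * D) =
   - c * \sum_(l < i * D) chi l.*2.+1%:Z * (((sin (y l) ^+ 2)^-1 - (y l ^+ 2)^-1) / 2).
  rewrite chi_dist_sum_half -/c /odd_sum !mulr_sumr -big_split /=; apply: eq_bigr => l _.
  have /andP[yl yl2] := yb l.
  have sy : sin (y l) != 0 by rewrite gt_eqF // sin_gt0_pi //; apply/andP; split; lra.
  rewrite zc; move: (sin (y l)) sy => s sy; rewrite /y /c.
  move: (pi : R) (lt0r_neq0 pi0) => P P0; move: (Num.sqrt _) => r.
  have kR : (l.*2.+1%:R : R) != 0 by rewrite pnatr_eq0.
  have [iR0 DR0] := (lt0r_neq0 iR, lt0r_neq0 DR).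
  by move: (l.*2.+1%:R : R) kR => k kR; field; rewrite kR P0 iR0 DR0 sy.
rewrite normrM normrN (ger0_norm c0).
apply: (@le_trans _ _ (c * ((i * D)%:R / 2))); last first.
  rewrite le_eqVlt; apply/orP; left; apply/eqP; rewrite /c natrM.
  by field; rewrite !gt_eqF.
rewrite ler_wpM2l //; apply: le_trans (ler_norm_sum _ _ _) _.
apply: (@le_trans _ _ (\sum_(l < i * D) 2^-1 : R)); last first.
  by rewrite sumr_const card_ord mulr_natl.
apply: ler_sum => l _; have /andP[b0 b1] := inv_sin2_bounds (yb l).
rewrite normrM [X in _ * X]ger0_norm; last exact: divr_ge0.
apply: (@le_trans _ _ (1 * (1 / 2))); last by rewrite !mul1r.
by rewrite ler_pM // ?divr_ge0 ?rchi_norm_le1 // ler_wpM2r.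
Qed.
End Level.

(** The even terms are those with chi(2 n) = chi(2) chi(n) and (2 n)^2 = 4 n^2. *)
Lemma series_odd_sum (X : nat) :
  \sum_(0 <= n < 2 * X) chi n.+1%:Z / n.+1%:R ^+ 2 =
  odd_sum X + chi 2 / 4 * \sum_(0 <= n < X) chi n.+1%:Z / n.+1%:R ^+ 2.
Proof.
rewrite /odd_sum -(big_mkord xpredT (fun l => chi l.*2.+1%:Z / l.*2.+1%:R ^+ 2)).
elim: X => [|X IH]; first by rewrite muln0 !big_geq // mulr0 addr0.
rewrite (_ : 2 * X.+1 = (2 * X).+2)%N; last by lia.
rewrite !big_nat_recr //= IH.
have -> : chi (2 * X).+2%:Z = chi 2 * chi X.+1%:Z.
  have -> : (2 * X).+2%:Z = 2 * X.+1%:Z by lia.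
  case: (boolP (coprimez D 2)) => D2; first by rewrite rchiM.
  rewrite !(rchi_noncoprime R fD (_ : ~~ coprimez D 2)) // mul0r.
  by rewrite rchi_noncoprime // coprimezMr (negbTE D2).
have -> : (2 * X).+2%:R = 2 * X.+1%:R :> R by rewrite -natrM; congr (_%:R); lia.
rewrite mul2n; field.
by rewrite !nat1r !pnatr_eq0.
Qed.

Local Open Scope classical_set_scope.

Definition rchi_L2_term (n : nat) : R := chi n.+1%:Z / n.+1%:R ^+ 2.

Lemma is_cvg_series_inv_sqr : cvgn (series (fun n => n.+1%:R ^- 2 : R)).
Proof.
apply: nondecreasing_is_cvgn.
  by apply: nondecreasing_series => n _ _; rewrite invr_ge0 exprn_ge0.
exists 2 => _ [n _ <-]; rewrite /series /=.
(* A telescoping bound; at n = 0 the convention 0^-1 = 0 makes it 2. *)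
apply: (@le_trans _ _ (2 - n%:R^-1 : R)); last by rewrite gerBl invr_ge0.
elim: n => [|n IH]; first by rewrite big_geq // invr0 subr0.
rewrite big_nat_recr //=; case: n IH => [|n] IH.
  by rewrite big_geq // add0r invr1 expr1n invr1; lra.
apply: le_trans (lerD IH (lexx _)) _.
have n0 : (0 : R) < n.+1%:R by rewrite ltr0n.
have -> : n.+2%:R = n.+1%:R + 1 :> R by rewrite natr1.
move: n0; move: (n.+1%:R : R) => x x0.
rewrite -subr_ge0 (_ : _ - _ = (x * (x + 1) ^+ 2)^-1); last first.
  by field; rewrite !gt_eqF // ltr_pwDl.
by rewrite invr_ge0 mulr_ge0 ?exprn_ge0 ?addr_ge0 // ltW.
Qed.

Lemma is_cvg_series_rchi_L2 : cvgn (series rchi_L2_term).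
Proof.
apply: normed_cvg; apply: series_le_cvg is_cvg_series_inv_sqr => n.
- exact: normr_ge0.
- by rewrite invr_ge0 exprn_ge0.
rewrite /rchi_L2_term /= normrM [X in _ * X]ger0_norm ?invr_ge0 ?exprn_ge0 //.
by rewrite ler_piMl ?rchi_norm_le1 // invr_ge0 exprn_ge0.
Qed.

(** Let i tend to infinity in [chi_dist_sum_approx]: the left side tends to 0, and the odd sums are
    differences of partial sums of L(2, chi) at 2 X and X. *)
Lemma chi_dist_sum_L2 :
  chi_dist_sum = - (2 * D%:R * Num.sqrt D%:R / pi ^+ 2) *
    ((1 - chi 2 / 4) * limn (series rchi_L2_term)).
Proof.
set c : R := 2 * D%:R * Num.sqrt D%:R / pi ^+ 2.
set L := limn _.
have sL : series rchi_L2_term @ \oo --> L := is_cvg_series_rchi_L2.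
(* Levels must be positive, hence [i.+1]. *)
pose X (i : nat) := (i.+1 * D)%N.
have X_oo : X @ \oo --> \oo.
  have -> : X = muln^~ D \o addn^~ 1%N by apply/funext => i; rewrite /X /= addn1.
  by apply: cvg_comp; [exact: cvg_addnr|exact: cvg_mulnr].
have s1 : (fun i => series rchi_L2_term (X i)) @ \oo --> L by apply: cvg_comp X_oo sL.
have s2 : (fun i => series rchi_L2_term (2 * X i)%N) @ \oo --> L.
  apply: (cvg_comp _ _ _ sL); apply: (cvg_comp _ _ X_oo); exact: cvg_mulnl.
have odd_lim : (fun i => odd_sum (X i)) @ \oo --> (1 - chi 2 / 4) * L.
  have -> : (fun i => odd_sum (X i)) =
      (fun i => series rchi_L2_term (2 * X i)%N - chi 2 / 4 * series rchi_L2_term (X i)).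
    by apply/funext => i; rewrite /series /= series_odd_sum addrK.
  rewrite mulrBl mul1r; apply: cvgB => //.
  by apply: cvgM => //; exact: cvg_cst.
have lim1 : (fun i => chi_dist_sum + c * odd_sum (X i)) @ \oo -->
    chi_dist_sum + c * ((1 - chi 2 / 4) * L).
  by apply: cvgD; [exact: cvg_cst|apply: cvgM => //; exact: cvg_cst].
have lim0 : (fun i => chi_dist_sum + c * odd_sum (X i)) @ \oo --> (0 : R).
  apply/norm_cvg0P.
  apply: (@squeeze_cvgr _ _ _ _ (fun=> 0) (fun i => Num.sqrt D%:R / 8 * harmonic i)).
  - apply: nearW => i; rewrite normr_ge0 /=.
    apply: le_trans (chi_dist_sum_approx (ltn0Sn i)) _.
    by rewrite /harmonic /= invfM mulrA.
  - exact: cvg_cst.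
  - rewrite -[X in _ --> X](mulr0 (Num.sqrt D%:R / 8)).
    by apply: cvgM; [exact: cvg_cst|exact: cvg_harmonic].
have e : chi_dist_sum + c * ((1 - chi 2 / 4) * L) = 0.
  exact: (cvg_unique (@Rhausdorff R) lim1 lim0).
by move/eqP: e; rewrite addr_eq0 mulNr => /eqP.
Qed.
End CharacterTriangle.

(** * Counting the boundary *)

(** The circle D and the coprimality modulus q are kept apart so that primes can be removed from q
    one at a time. *)
Definition coprime_dist_sum (D q : nat) : nat := \sum_(d < D) coprime q d * circle_dist D d.

Lemma double_sum_ord (k : nat) : (2 * (\sum_(d < k) d) = k * k.-1)%N.
Proof.
elim: k => [|k IH]; first by rewrite big_ord0.
rewrite big_ord_recr mulnDr IH /=; case: k {IH} => // k; rewrite /=; lia.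
Qed.

Lemma coprime_dist_sum1 (n : nat) : odd n -> (4 * coprime_dist_sum n 1 = n ^ 2 - 1)%N.
Proof.
move=> on; have [k ->] : exists k, n = (k.+1 + k)%N by exists n./2; lia.
rewrite /coprime_dist_sum big_split_ord /=.
have -> : (\sum_(i < k.+1) coprime 1 i * circle_dist (k.+1 + k) i = \sum_(i < k.+1) i)%N.
  by apply: eq_bigr => i _; rewrite coprime1n mul1n /circle_dist; have := ltn_ord i; lia.
have -> : (\sum_(i < k) coprime 1 (k.+1 + i) * circle_dist (k.+1 + k) (k.+1 + i) =
           \sum_(i < k.+1) i)%N.
  rewrite big_ord_recl add0n (reindex_inj rev_ord_inj) /=; apply: eq_bigr => i _.
  by rewrite coprime1n mul1n /circle_dist /bump /=; have := ltn_ord i; lia.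
have := double_sum_ord k.+1; rewrite expnS expn1 /=; nia.
Qed.

Lemma sum_multiples (p e : nat) (g : nat -> nat) : (0 < p)%N ->
  (\sum_(d < e * p) (p %| d) * g d = \sum_(d < e) g (d * p))%N.
Proof.
move=> p0; elim: e => [|e IH]; first by rewrite mul0n !big_ord0.
rewrite -(big_mkord xpredT (fun d => (p %| d) * g d)%N) mulSn addnC.
rewrite (big_cat_nat (n := e * p)) ?leq_addr //= big_mkord IH big_ord_recr /=.
congr (_ + _)%N; rewrite -{1}(add0n (e * p)%N) big_addn addKn.
rewrite big_ltn // add0n dvdn_mull // mul1n big_nat_cond big1 ?addn0 //.
move=> i; rewrite andbT => /andP[i0 ip].
by rewrite dvdn_addl ?dvdn_mull // gtnNdvd.
Qed.

Lemma circle_dist_mul (D e p : nat) : circle_dist (e * p) (D * p) = (p * circle_dist e D)%N.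
Proof. by rewrite /circle_dist -mulnBl -minnMl mulnC. Qed.

(** The multiples of p on the circle of length e p form a copy of the circle of length e, scaled by
    p; they are what coprimality to p removes. *)
Lemma coprime_dist_sum_step (p q e : nat) : prime p -> coprime p q -> (0 < q)%N ->
  (coprime_dist_sum (e * p) (p * q) + p * coprime_dist_sum e q = coprime_dist_sum (e * p) q)%N.
Proof.
move=> pp pq q0; have p0 := prime_gt0 pp.
have -> : (p * coprime_dist_sum e q =
           \sum_(d < e * p) (p %| d) * (coprime q d * circle_dist (e * p) d))%N.
  rewrite (sum_multiples e (fun d => coprime q d * circle_dist (e * p) d)%N p0).
  rewrite /coprime_dist_sum big_distrr /=; apply: eq_bigr => d _.
  by rewrite circle_dist_mul coprimeMr (coprime_sym q p) pq andbT mulnCA.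
rewrite /coprime_dist_sum -big_split /=; apply: eq_bigr => d _.
rewrite coprimeMl prime_coprime //; case: (p %| d)%N => /=.
  by rewrite mul0n add0n mul1n.
by rewrite mul0n addn0.
Qed.

Lemma size_primes_mul (p q : nat) : prime p -> coprime p q -> (0 < q)%N ->
  size (primes (p * q)) = (size (primes q)).+1.
Proof.
move=> pp pq q0; have p0 := prime_gt0 pp.
rewrite -/(size (p :: primes q)); apply: perm_size; apply: uniq_perm.
- exact: primes_uniq.
- by rewrite /= primes_uniq mem_primes pp q0 -prime_coprime // pq.
by move=> r; rewrite primesM // inE primes_prime // inE.
Qed.

(** Strong induction on q, removing its least prime p. D varies as well, since the removed part
    lives on the circle of length D / p. Both sides carry a factor q to stay in the integers. *)
Lemma coprime_dist_sum_odd (D q : nat) : (0 < q)%N -> odd D -> (q %| D)%N ->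
  (forall p, prime p -> ~~ (p ^ 2 %| q)%N) ->
  4 * q%:Z * (coprime_dist_sum D q)%:Z =
  D%:Z ^+ 2 * (totient q)%:Z - q%:Z * ((-1) ^+ size (primes q) * (totient q)%:Z).
Proof.
elim: q {-2}q (leqnn q) D => [|n IH] q; first by rewrite leqn0 lt0n => ->.
move=> qn D q0 oD qD sq; have [q1|q1] := leqP q 1.
  have -> : q = 1%N by lia.
  have D0 : (0 < D)%N by case: D oD {qD}.
  have := coprime_dist_sum1 oD => e.
  have : (4 * coprime_dist_sum D 1).+1 = (D ^ 2)%N by rewrite e subn1 prednK // expn_gt0 D0.
  rewrite (_ : totient 1 = 1%N) // (_ : primes 1 = [::]) //= expr0 !mulr1 -mulnn => e'.
  by rewrite expr2 -PoszM -e'; lia.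
have pp := pdiv_prime q1; set p := pdiv q in pp.
have p0 := prime_gt0 pp; have p1 := prime_gt1 pp.
have qE : q = (p * (q %/ p))%N by rewrite mulnC divnK // pdiv_dvd.
set q' := (q %/ p)%N in qE.
have q'0 : (0 < q')%N by move: q0; rewrite qE muln_gt0 => /andP[].
have pq : coprime p q'.
  rewrite prime_coprime //; apply/negP => h; have := sq p pp.
  by rewrite qE expnS expn1 dvdn_pmul2l // h.
have pD : (p %| D)%N by apply: dvdn_trans qD; rewrite pdiv_dvd.
have DE : D = (D %/ p * p)%N by rewrite divnK.
set e := (D %/ p)%N in DE.
have q'D : (q' %| D)%N by apply: dvdn_trans qD; rewrite qE dvdn_mull.
have q'e : (q' %| e)%N by move: qD; rewrite qE DE (mulnC e) dvdn_pmul2l.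
have oe : odd e by move: oD; rewrite DE oddM => /andP[].
have q'n : (q' <= n)%N by rewrite -ltnS (leq_trans _ qn) // qE ltn_Pmull.
have sq' r : prime r -> ~~ (r ^ 2 %| q')%N.
  by move=> /sq; apply: contra => h; rewrite qE dvdn_mull.
have h1 := IH q' q'n D q'0 oD q'D sq'; have h2 := IH q' q'n e q'0 oe q'e sq'.
have := coprime_dist_sum_step e pp pq q'0; rewrite -DE -qE => h3.
have -> : size (primes q) = (size (primes q')).+1 by rewrite qE size_primes_mul.
have -> : (totient q)%:Z = (p%:Z - 1) * (totient q')%:Z.
  by rewrite qE totient_coprime // totient_prime // PoszM predn_int.
have -> : (coprime_dist_sum D q)%:Z =
    (coprime_dist_sum D q')%:Z - p%:Z * (coprime_dist_sum e q')%:Z.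
  by rewrite -h3 PoszD PoszM addrK.
rewrite qE PoszM [(-1) ^+ _.+1]exprS.
have DZ : D%:Z = e%:Z * p%:Z by rewrite {1}DE PoszM.
rewrite DZ in h1 *.
transitivity (p%:Z * (4 * q'%:Z * (coprime_dist_sum D q')%:Z)
              - p%:Z ^+ 2 * (4 * q'%:Z * (coprime_dist_sum e q')%:Z)).
  by ring.
by rewrite h1 h2; ring.
Qed.

Lemma coprime_half (H d : nat) : ~~ odd H -> coprime (H + H) (H + d) = coprime (H + H) d.
Proof.
move=> oH; have E x : coprime (H + H) x = coprime H x.
  rewrite addnn -mul2n coprimeMl; case: (boolP (coprime H x)) => // h; last by rewrite andbF.
  rewrite andbT; apply: coprime_dvdl h; by rewrite dvdn2.
by rewrite !E /coprime gcdnDl.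
Qed.

(** The residues d and d + D / 2 are prime to D together, and their distances add up to D / 2. *)
Lemma coprime_dist_sum_four (D : nat) : (4 %| D)%N ->
  (4 * coprime_dist_sum D D = D * totient D)%N.
Proof.
case/dvdnP => k Dk; have DE : D = (2 * k + 2 * k)%N by lia.
move: (2 * k)%N (oddM 2 k) DE => H oH ->.
have {}oH : ~~ odd H by rewrite oH.
rewrite totient_count_coprime big_mkord /coprime_dist_sum !big_split_ord /=.
rewrite -big_split /= -[X in _ = (_ * X)%N]big_split /=.
under eq_bigr => d _.
  rewrite coprime_half // (_ : circle_dist (H + H) d = d); last first.
    by rewrite /circle_dist; have := ltn_ord d; lia.
  rewrite (_ : circle_dist (H + H) (H + d) = H - d)%N; last first.
    by rewrite /circle_dist; have := ltn_ord d; lia.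
  rewrite -mulnDr subnKC; last exact: ltnW.
  over.
under [in RHS]eq_bigr => d _ do rewrite coprime_half // addnn -mul2n.
by rewrite -big_distrl /= -big_distrr /=; set c := (\sum_(_ < _) _)%N; lia.
Qed.

(** * The cut at half the circle *)

Section CheegerBound.
Variable R : realType.
Variable D : nat.
Hypothesis fD : fundamental_disc D.
Local Notation chi := (rchi R D).
Let D1 : (1 < D)%N := fundamental_gt1 fD.
Let D0 : (0 < D)%N. Proof. exact: ltnW. Qed.

Lemma coprime_dist_sum_mobius :
  4 * (coprime_dist_sum D D)%:R = D%:R * (totient D)%:R - (mobius D)%:~R * (totient D)%:R :> R.
Proof.
case: fD => [/andP[/andP[/eqP D4 _] sf]|[m [Dm m4 sf]]].
  have DZ : D%:Z != 0 by rewrite eqz_nat -lt0n.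
  have oD : odd D by lia.
  have := coprime_dist_sum_odd D0 oD (dvdnn D) (fun p => squarefree_prime D0 sf (p := p)).
  rewrite /mobius sf => e.
  have {}e : 4 * (coprime_dist_sum D D)%:Z =
      D%:Z * (totient D)%:Z - (-1) ^+ size (primes D) * (totient D)%:Z.
    by apply: (mulfI DZ); rewrite mulrCA mulrA e; ring.
  by have := congr1 (intr : int -> R) e; rewrite !(rmorphB, rmorphM) /=.
have -> : mobius D = 0.
  rewrite /mobius ifN //; apply/forallPn; have D2 : (2 < D.+1)%N by lia.
  by exists (Ordinal D2); rewrite /= Dm dvdn_mulr.
rewrite mul0r subr0 -!natrM coprime_dist_sum_four // Dm dvdn_mulr //.
Qed.

Lemma sum_between (n a b : nat) : (\sum_(0 <= u < n) (a <= u < b) = minn n b - a)%N.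
Proof.
elim: n => [|n IH]; first by rewrite big_geq // min0n.
by rewrite big_nat_recr //= IH; lia.
Qed.

(** A difference d crosses the cut for u from [D./2 - d] up to, but excluding, min([D./2], D - d):
    this makes ||d|| values. The truncated subtraction is harmless, as the indicator forces u <
    v. *)
Lemma sum_cut (f : nat -> R) :
  \sum_(u < D) \sum_(v < D) ((u < D./2) && (D./2 <= v))%N%:R * f (v - u)%N =
  \sum_(d < D) (circle_dist D d)%:R * f d.
Proof.
transitivity (\sum_(u < D) \sum_(d < D) ((u < D./2) && (D./2 <= u + d < D))%N%:R * f d).
  apply: eq_bigr => u _; have [uh|uh] := ltnP u D./2; last first.
    by rewrite !big1 // => *; rewrite mul0r.
  rewrite -(big_mkord xpredT (fun v => (D./2 <= v)%N%:R * f (v - u)%N)).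
  rewrite -(big_mkord xpredT (fun d => (D./2 <= u + d < D)%N%:R * f d)).
  rewrite (big_cat_nat (n := u)) ?(ltnW (ltn_ord u)) //= big_nat_cond big1 ?add0r; last first.
    by move=> v; rewrite andbT => /andP[_ vu]; rewrite leqNgt (ltn_trans vu uh) mul0r.
  rewrite -{1}(add0n (u : nat)) big_addn.
  rewrite [RHS](big_cat_nat (n := D - u)) ?leq_subr //= [X in _ = _ + X]big_nat_cond.
  rewrite [X in _ = _ + X]big1 ?addr0; last first.
    move=> d; rewrite andbT => /andP[ud _].
    rewrite (_ : (u + d < D)%N = false) ?andbF ?mul0r //.
    lia.
  apply: eq_big_nat => d /andP[_ dD]; rewrite addnK addnC.
  by rewrite (_ : (u + d < D)%N = true) ?andbT //; lia.
rewrite exchange_big /=; apply: eq_bigr => d _; rewrite -mulr_suml; congr (_ * _).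
rewrite -natr_sum; congr (_%:R).
rewrite -(big_mkord xpredT (fun u => ((u < D./2) && (D./2 <= u + d < D) : nat)%N)).
transitivity (\sum_(0 <= u < D) (D./2 - d <= u < minn D./2 (D - d)))%N.
  by apply: eq_big_nat => u /andP[_ uD]; congr nat_of_bool; have := ltn_ord d; lia.
by rewrite sum_between /circle_dist; have := ltn_ord d; lia.
Qed.

(** Boundary edges are images of ordered pairs (inner end, outer end). An inequality suffices for an
    upper bound on the Cheeger number. *)
Lemma card_edge_boundary_le (V : finType) (adj : rel V) (F : {set V}) :
  (#|edge_boundary adj F| <= \sum_u \sum_v [&& u \in F, v \notin F & adj u v])%N.
Proof.
pose P := [set w : V * V | [&& w.1 \in F, w.2 \notin F & adj w.1 w.2]].
have sub : edge_boundary adj F \subset [set [set w.1; w.2] | w in P].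
  apply/fintype.subsetP => e /imset2P[u v uF]; rewrite !inE => /andP[vF uv] ->.
  by apply/imsetP; exists (u, v) => //; rewrite inE /= uF vF.
apply: leq_trans (subset_leq_card sub) _; apply: leq_trans (leq_imset_card _ _) _.
rewrite pair_bigA /= -sum1_card big_mkcond /=.
by apply: leq_sum => w _; rewrite inE; case: ifP.
Qed.

(** On the values 0, 1, -1 the polynomial (x^2 + x) / 2 is the indicator of 1; its two terms give
    the principal and the quadratic part of the count. *)
Lemma kronecker_eq1 (k : int) : (kronecker D k == 1)%:R = (chi k * chi k + chi k) / 2.
Proof.
case: (boolP (coprimez D k)) => Dk; last first.
  by rewrite !rchi_noncoprime // kronecker_noncoprime // mulr0 addr0 mul0r.
have [e|e] : kronecker D k = 1 \/ kronecker D k = -1.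
  have := rchi_sqr R fD Dk; rewrite /rchi -intrM -[1]/(1%:~R) => /eqP.
  by rewrite eqr_int -expr2 sqrf_eq1 => /orP[]/eqP ->; [left|right].
  by rewrite /rchi e eqxx mulr1z /=; field.
by rewrite /rchi e mulrN1z (_ : (-1 == 1 :> int) = false) //=; field.
Qed.

Lemma rchi_sqr_coprime (d : nat) : chi d%:Z * chi d%:Z = (coprime D d)%:R.
Proof.
case: (boolP (coprime D d)) => Dd; first by rewrite rchi_sqr.
by rewrite rchi_noncoprime // mul0r.
Qed.

Lemma cheeger_bound :
  cheeger_number R (@paley_adj D%:Z) <=
    1 / (8 * (D %/ 2)%:R) *
    (D%:R * (totient D)%:R - (mobius D)%:~R * (totient D)%:R
     - 8 * D%:R * Num.sqrt D%:R / pi ^+ 2 *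
       (1 - (kronecker D%:Z 2)%:~R / 4) * dirichlet_L R 2 (kronecker D%:Z)).
Proof.
pose N := D./2; pose F := [set u : 'I_D | (u < N)%N].
have N0 : (0 < N)%N by rewrite /N; lia.
have NR : (0 : R) < N%:R by rewrite ltr0n.
have cF : #|F| = N.
  rewrite -sum1_card (eq_bigl (fun u : 'I_D => (u < N)%N)); last by move=> u; rewrite inE.
  rewrite -(big_ord_widen D (fun=> 1%N)); last by rewrite /N; lia.
  by rewrite sum1_card card_ord.
have admF : cheeger_admissible F.
  by rewrite /cheeger_admissible cF N0 card_ord /N; lia.
have V1 : (1 < #|'I_D|)%N by rewrite card_ord.
have [_ /(_ F admF) le] := @cheeger_number_min R _ (@paley_adj D%:Z) V1.
apply: (le_trans le); rewrite /cheeger_ratio cF.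
have bd : (#|edge_boundary (@paley_adj D%:Z) F|)%:R <=
    ((coprime_dist_sum D D)%:R + chi_dist_sum R D) / 2 :> R.
  apply: (@le_trans _ _ (\sum_(u < D) \sum_(v < D)
      [&& u \in F, v \notin F & paley_adj (Delta := D%:Z) u v])%N%:R).
    by rewrite ler_nat card_edge_boundary_le.
  rewrite natr_sum; under eq_bigr => u _ do rewrite natr_sum.
  pose f (d : nat) : R := (chi d%:Z * chi d%:Z + chi d%:Z) / 2.
  rewrite (eq_bigr (fun u : 'I_D => \sum_(v < D)
    ((u < N)%N && (N <= v)%N)%:R * f (v - u)%N)); last first.
    move=> u _; apply: eq_bigr => v _; rewrite !inE -leqNgt.
    case: (ltnP u N) => [uN|]; last by rewrite mul0r.
    case: (leqP N v) => [Nv|]; last by rewrite mul0r.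
    by rewrite /= mul1r /f -kronecker_eq1 /paley_adj subzn // ltnW // (leq_trans uN).
  rewrite sum_cut /coprime_dist_sum /chi_dist_sum natr_sum -big_split /= mulr_suml.
  rewrite le_eqVlt; apply/orP; left; apply/eqP; apply: eq_bigr => d _.
  by rewrite /f rchi_sqr_coprime natrM; field.
apply: (@le_trans _ _ (((coprime_dist_sum D D)%:R + chi_dist_sum R D) / 2 / N%:R)).
  by rewrite ler_pM2r ?invr_gt0.
have -> : (D %/ 2)%N = N by rewrite divn2.
(* Convertible, since [rchi] is the symbol cast into R. *)
have <- : limn (series (rchi_L2_term R D)) = dirichlet_L R 2 (kronecker D) by [].
rewrite -coprime_dist_sum_mobius (chi_dist_sum_L2 R fD) -/(rchi R D 2).
rewrite le_eqVlt; apply/orP; left; apply/eqP; move: (limn _) (chi 2) (Num.sqrt _).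
move: (pi : R) (pi_gt0 R) => P P0 L x s.
by field; rewrite (lt0r_neq0 NR) (lt0r_neq0 P0).
Qed.
End CheegerBound.

Theorem theorem5p2 (R : realType) (m : int) :
  m != 1 -> squarefree `|m|%N -> 0 < quad_disc m ->
  let Delta := quad_disc m in
  let D := `|Delta|%N in
  let chi := kronecker Delta in
  cheeger_number R (@paley_adj Delta) <=
    1 / (8 * (D %/ 2)%:R) *
    (D%:R * (totient D)%:R - (mobius D)%:~R * (totient D)%:R
     - 8 * D%:R * Num.sqrt D%:R / pi ^+ 2 *
       (1 - (chi 2)%:~R / 4) * dirichlet_L R 2 chi).
Proof.
move=> m1 sf.
have : forall D : nat, quad_disc m = D%:Z -> (0 < D)%N -> fundamental_disc D.
  move=> D; rewrite /quad_disc; case: ifP => [/eqP m4 mD|m4 mD] D0.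
    left; rewrite -[D]/(`|D%:Z|%N) -mD sf andbT.
    (* Here m != 1 is what gives 1 < D. *)
    by move: m1 m4; rewrite mD => D1 D4; apply/andP; split; lia.
  right; exists `|m|%N.
  have mE : m = `|m|%N%:Z by lia.
  have m0 : (0 < `|m|)%N by lia.
  (* Squarefreeness at 2 excludes m = 0 modulo 4, leaving 2 and 3. *)
  have := squarefree_prime m0 sf (isT : prime 2); move: m4 mD; rewrite mE /= modz_nat.
  by move=> m4 mD h; split => //; move: h m4 mD; rewrite /dvdn; lia.
case: (quad_disc m) => // D /(_ D erefl) fD D0.
exact: cheeger_bound (fD D0).
Qed.
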